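(* Consider a sequence (indexed by $n\to\infty$) of attributed Erdős–Rényi pairs $\mathcal{G}(n,\bm p;m,\bm p)$ (i.e. with $\bm q=\bm p$), where $m$ and $\bm p$ may depend on $n$. Let $\psi_{\mathrm u}=(\sqrt{p_{11}p_{00}}-\sqrt{p_{10}p_{01}})^2$. Achievability: If either (a) $(n+m)\psi_{\mathrm u}-2\log n\to+\infty$, or (b) $p_{11}=O\left(\tfrac{\log n}{n}\right)$, $p_{10}+p_{01}=O\left(\tfrac1{\log n}\right)$, $\dfrac{p_{10}p_{01}}{p_{11}p_{00}}=O\left(\tfrac1{(\log n)^3}\right)$ and $np_{11}+m\psi_{\mathrm u}-\log n\to+\infty$, then the MAP estimator achieves exact alignment with high probability, i.e. $\lim_{n\to\infty}\mathsf P(\hat\pi_{\mathrm{MAP}}(G_1,G_2')\ne\Pi^* )=0$. Converse: If $\log n-(n+m)p_{11}\to+\infty$, then for any estimator the probability of error is bounded away from zero: for any sequence of estimators $\hat\pi$, $\liminf_{n\to\infty}\mathsf P(\hat\pi(G_1,G_2')\neq\Pi^* )>0$.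
   Context: Attributed Erdős–Rényi pair $\mathcal{G}(n,\bm p;m,\bm q)$: two random graphs $G_1,G_2$ on a common vertex set consisting of $n$ user vertices $\mathcal V_{\mathrm u}=[n]$ and $m$ attribute vertices $\mathcal V_{\mathrm a}$ (disjoint from $\mathcal V_{\mathrm u}$). Let $\mathcal E_{\mathrm u}$ be the set of (unordered) pairs of distinct users and $\mathcal E_{\mathrm a}=\mathcal V_{\mathrm u}\times\mathcal V_{\mathrm a}$; there are no edges between attribute vertices. $G_k(e)\in\{0,1\}$ indicates whether $e$ is an edge of $G_k$. Independently over $e\in\mathcal E_{\mathrm u}\cup\mathcal E_{\mathrm a}$, $\mathsf P((G_1(e),G_2(e))=(a,b))=p_{ab}$ for $e\in\mathcal E_{\mathrm u}$ and $=q_{ab}$ for $e\in\mathcal E_{\mathrm a}$ ($a,b\in\{0,1\}$), where $\bm p=(p_{11},p_{10},p_{01},p_{00})$ and $\bm q=(q_{11},q_{10},q_{01},q_{00})$ are probability vectors. Standing assumption: $G_1(e)$ and $G_2(e)$ are positively correlated for every $e$ (correlation coefficient defined and $>0$). Anonymization: $\Pi^*$ is uniform on the set $\mathcal S_n$ of permutations of $[n]$, independent of $(G_1,G_2)$, and $G_2'$ is obtained from $G_2$ by relabeling each user $i$ as $\Pi^*(i)$ (attribute vertices keep their labels). An estimator is a function $\hat\pi(G_1,G_2')\in\mathcal S_n$. The MAP estimator $\hat\pi_{\mathrm{MAP}}(G_1,G_2')$ is a maximizer over $\pi\in\mathcal S_n$ of the posterior $\mathsf P(\Pi^*=\pi\mid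 G_1,G_2')$. $f(n)=O(g(n))$ means $\limsup_{n\to\infty}|f(n)|/g(n)<\infty$. *)

(* Defs.v *)
From HB Require Import structures.
From mathcomp Require Import all_boot all_order all_fingroup all_algebra.
From mathcomp Require Import all_classical all_reals all_analysis.

Set Implicit Arguments.
Unset Strict Implicit.
Unset Printing Implicit Defensive.

Import Order.TTheory GRing.Theory Num.Theory.
Import numFieldNormedType.Exports.

Local Open Scope ring_scope.

(* Users are 'I_n, attributes are 'I_m; a user-user edge is a 2-element set. *)
Definition user_pair (n : nat) := {A : {set 'I_n} | #|A| == 2%N}.

Definition edge (n m : nat) := (user_pair n + 'I_n * 'I_m)%type.

Definition graph (n m : nat) := {ffun edge n m -> bool}.

Lemma card_relabel_pair (n : nat) (s : {perm 'I_n}) (e : user_pair n) :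
  #|s @: val e| == 2%N.
Proof. by rewrite card_imset ?(valP e) //; apply: perm_inj. Qed.

Definition relabel_pair (n : nat) (s : {perm 'I_n}) (e : user_pair n) :
    user_pair n :=
  exist _ (s @: val e) (card_relabel_pair s e).

Definition relabel_edge (n m : nat) (s : {perm 'I_n}) (e : edge n m) :
    edge n m :=
  match e with
  | inl u => inl (relabel_pair s u)
  | inr (i, a) => inr (s i, a)
  end.

(* User i is renamed s i: the edge s(e) is present in the new graph iff e is
   present in G. *)
Definition relabel_graph (n m : nat) (s : {perm 'I_n}) (G : graph n m) :
    graph n m :=
  [ffun e => G (relabel_edge (s^-1)%g e)].

Section PairLaw.
Variable R : realType.

(* p a b is p_{ab}, the probability that (G1(e), G2(e)) = (a, b). *)
Definition prob_vector (p : bool -> bool -> R) : Prop :=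
  (forall a b, 0 <= p a b) /\ \sum_(a : bool) \sum_(b : bool) p a b = 1.

Definition pair_mean (p : bool -> bool -> R) (X : bool -> bool -> R) : R :=
  \sum_(a : bool) \sum_(b : bool) p a b * X a b.

Definition pair_cov (p X Y : bool -> bool -> R) : R :=
  pair_mean p
    (fun a b => (X a b - pair_mean p X) * (Y a b - pair_mean p Y)).

Definition edge_ind1 (a b : bool) : R := a%:R.
Definition edge_ind2 (a b : bool) : R := b%:R.

Definition correlation (p : bool -> bool -> R) : R :=
  pair_cov p edge_ind1 edge_ind2 /
  (Num.sqrt (pair_cov p edge_ind1 edge_ind1) *
   Num.sqrt (pair_cov p edge_ind2 edge_ind2)).

(* The correlation coefficient is defined when both variances are nonzero. *)
Definition positively_correlated (p : bool -> bool -> R) : Prop :=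
  [/\ 0 < pair_cov p edge_ind1 edge_ind1,
      0 < pair_cov p edge_ind2 edge_ind2 &
      0 < correlation p].

Definition psi (p : bool -> bool -> R) : R :=
  (Num.sqrt (p true true * p false false)
   - Num.sqrt (p true false * p false true)) ^+ 2.

End PairLaw.

Section Alignment.
Variables (R : realType) (n m : nat).

(* An outcome is a triple (G1, G2, Pi). *)
Definition outcome := (graph n m * graph n m * {perm 'I_n})%type.

Definition G1 (w : outcome) : graph n m := w.1.1.
Definition G2 (w : outcome) : graph n m := w.1.2.
Definition Pistar (w : outcome) : {perm 'I_n} := w.2.
Definition G2' (w : outcome) : graph n m := relabel_graph (Pistar w) (G2 w).

Definition edge_law (p q : bool -> bool -> R) (e : edge n m) :
    bool -> bool -> R :=
  match e with inl _ => p | inr _ => q end.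

(* Edges independent; Pi uniform and independent of (G1, G2). *)
Definition mass (p q : bool -> bool -> R) (w : outcome) : R :=
  (\prod_(e : edge n m) edge_law p q e (G1 w e) (G2 w e))
  * (#|{: {perm 'I_n}}|%:R)^-1.

Definition Pr (p q : bool -> bool -> R) (A : pred outcome) : R :=
  \sum_(w : outcome | A w) mass p q w.

Definition estimator := graph n m -> graph n m -> {perm 'I_n}.

(* On observations of probability 0 this is 0 for every s (division by 0), so
   that is_MAP does not constrain the estimator there. *)
Definition posterior (p q : bool -> bool -> R) (g1 g2' : graph n m)
    (s : {perm 'I_n}) : R :=
  Pr p q (fun w => [&& Pistar w == s, G1 w == g1 & G2' w == g2'])
  / Pr p q (fun w => (G1 w == g1) && (G2' w == g2')).

(* Ties may be broken arbitrarily. *)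
Definition is_MAP (p q : bool -> bool -> R) (est : estimator) : Prop :=
  forall (g1 g2' : graph n m) (s : {perm 'I_n}),
    posterior p q g1 g2' s <= posterior p q g1 g2' (est g1 g2').

Definition error_prob (p q : bool -> bool -> R) (est : estimator) : R :=
  Pr p q (fun w => est (G1 w) (G2' w) != Pistar w).

End Alignment.

(* Main.v *)
Require Import Defs.
From HB Require Import structures.
From mathcomp Require Import all_boot all_order all_fingroup all_algebra.
From mathcomp Require Import all_classical all_reals all_analysis.
From mathcomp Require Import zify lra ring.

Set Implicit Arguments.
Unset Strict Implicit.
Unset Printing Implicit Defensive.

Import Order.TTheory GRing.Theory Num.Theory.
Import numFieldNormedType.Exports.

Local Open Scope ring_scope.

(* Achievability.  If the MAP estimate is wrong, then some s <> 1 satisfies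
   L(s) >= L(1), where L(s) is the likelihood of (G1, G2 o s).  Summing the variables
   G2(e) out one at a time along the orbits of edges under s, by Cauchy-Schwarz, gives
     E[(L(s) / L(1))^(1/2) y^M] <= |A_y|^t,
   where t is the number of edges moved by s, M the number of moved edges common to G1
   and G2, and |A_y| the Hilbert-Schmidt norm of a 2 x 2 transfer matrix, with
   |A_1|^2 = 1 - 2 psi.  There are at most n^k permutations moving k users, and they
   move at least k (n + m - (k + 3) / 2) edges; with y = 1 the union bound settles
   condition (a), and the permutations with k <= 32 n / log n under condition (b).  For the
   remaining ones, a union bound over the 2^n sets S of users shows that, with high
   probability, S touches at least |S| (n + m) p11 / 16 common edges whenever
   |S| > 32 n / log n, and the bound above is then used with y = exp 96.

   Converse.  Two users isolated in the intersection of G1 and G2 can be swapped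
   without decreasing the likelihood, so P(error) is at least half the probability that
   there are two such users; this is bounded below by the second moment method. *)

(** * Cyclic sums along a permutation, by Cauchy-Schwarz *)

Lemma sqrt_cauchy_schwarz2 (R : rcfType) (a b c d : R) :
  a * c + b * d <=
  Num.sqrt (a ^+ 2 + b ^+ 2) * Num.sqrt (c ^+ 2 + d ^+ 2).
Proof.
rewrite -sqrtrM ?addr_ge0 ?sqr_ge0 //.
apply: le_trans (ler_norm _) _; rewrite -sqrtr_sqr ler_sqrt; last first.
  by rewrite mulr_ge0 ?addr_ge0 ?sqr_ge0.
rewrite -subr_ge0.
rewrite (_ : _ - _ = (a * d - b * c) ^+ 2) ?sqr_ge0 //; ring.
Qed.

Section CycleSum.
Import boot.finset.
Variables (R : rcfType) (E : finType) (s : {perm E}) (B : E -> bool -> bool -> R).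
Hypothesis B_ge0 : forall e x y, 0 <= B e x y.

(* The factor attached to e once the variables in S have been summed out. *)
Let U (S : {set E}) (e : E) (x y : bool) : R :=
  if s e == e then (if e \in S then \sum_b B e b b else B e x x)
  else Num.sqrt (\sum_(x' | (e \in S) || (x' == x))
                   \sum_(y' | (s e \in S) || (y' == y)) B e x' y' ^+ 2).

Let upd (v : E) (g : {ffun E -> bool}) (x : bool) : {ffun E -> bool} :=
  [ffun e => if e == v then x else g e].

(** Flipping the value at [v] is an involution on configurations, so resampling that coordinate
    counts each configuration twice. *)
Let sum_upd (v : E) (F : {ffun E -> bool} -> R) :
  \sum_g F g = 2^-1 * \sum_g \sum_x F (upd v g x).
Proof.
pose fl g := upd v g (~~ g v).
have flK : involutive fl.
  move=> g; apply/ffunP=> e; rewrite !ffunE eqxx.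
  by case: eqP => [->|//]; rewrite negbK.
have updE g : upd v g (g v) = g.
  by apply/ffunP=> e; rewrite ffunE; case: eqP => [->|].
have -> : \sum_g \sum_x F (upd v g x) = \sum_g (F g + F (fl g)).
  apply: eq_bigr => g _; rewrite big_bool -{3}(updE g) /fl.
  by case: (g v) => //=; rewrite addrC.
rewrite big_split /= [X in X + _](reindex_inj (inv_inj flK)) -mulr2n.
rewrite [LHS](reindex_inj (inv_inj flK)) /= -[X in _ * X]mulr_natl.
by rewrite mulrA mulVf ?mul1r // pnatr_eq0.
Qed.

Let U_ge0 S e x y : 0 <= U S e x y.
Proof.
by rewrite /U; case: ifP => // _; case: ifP => // _; apply: sumr_ge0.
Qed.

Let U_other S v e x y : e != v -> s e != v -> U (v |: S) e x y = U S e x y.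
Proof. by move=> ev sv; rewrite /U !in_setU1 (negbTE ev) (negbTE sv). Qed.

Let sumsq_ge0 e (P Q : pred bool) :
  0 <= \sum_(x | P x) \sum_(y | Q y) B e x y ^+ 2.
Proof. by apply: sumr_ge0 => x _; apply: sumr_ge0 => y _; rewrite sqr_ge0. Qed.

(** Only the factors at [v] and at its preimage [u] depend on [g v]. If [s] fixes [v] they coincide
    and the sum is a trace; otherwise Cauchy-Schwarz in [g v] separates them, each becoming the root
    of its sum of squares over that variable. *)
Let step (S : {set E}) (v : E) (g : {ffun E -> bool}) : v \notin S ->
  \sum_x \prod_e U S e (upd v g x e) (upd v g x (s e)) <=
  \prod_e U (v |: S) e (g e) (g (s e)).
Proof.
move=> vS; rewrite [leRHS](bigD1 v) //=.
have updN x e : e != v -> upd v g x e = g e by rewrite ffunE => /negbTE->.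
have updv x : upd v g x v = x by rewrite ffunE eqxx.
have [sv|sv] := eqVneq (s v) v.
  have neq e : e != v -> s e != v.
    by apply: contra => /eqP se; rewrite -(inj_eq (@perm_inj _ s)) se sv.
  rewrite [X in _ <= _ * X](eq_bigr (fun e => U S e (g e) (g (s e)))); last first.
    by move=> e ev; rewrite U_other // neq.
  rewrite (eq_bigr (fun x => B v x x *
      \prod_(e | e != v) U S e (g e) (g (s e)))); last first.
    move=> x _; rewrite (bigD1 v) //= {1}/U sv eqxx (negbTE vS) updv.
    by congr (_ * _); apply: eq_bigr => e ev; rewrite !updN ?neq.
  by rewrite -mulr_suml [U (_ |: _) _ _ _]/U sv eqxx setU11.
pose u := (s^-1)%g v.
have su : s u = v by rewrite /u permKV.
have uv : u != v by apply: contraNneq sv => uv; rewrite -{1}uv su.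
rewrite [X in _ <= _ * X](bigD1 u) //=.
rewrite [X in _ <= _ * (_ * X)](eq_bigr (fun e => U S e (g e) (g (s e)))); last first.
  move=> e /andP[ev eu]; rewrite U_other //.
  by apply: contraNneq eu => sev; rewrite /u -sev permK.
rewrite (eq_bigr (fun x => (U S v x (g (s v)) * U S u (g u) x) *
    \prod_(e | (e != v) && (e != u)) U S e (g e) (g (s e)))); last first.
  move=> x _; rewrite (bigD1 v) //= (bigD1 u) //= su updv !updN // mulrA.
  congr (_ * _); apply: eq_bigr => e /andP[ev eu]; rewrite !updN //.
  by apply: contraNneq eu => sev; rewrite /u -sev permK.
rewrite -mulr_suml mulrA ler_wpM2r //; first by apply: prodr_ge0.
rewrite big_bool; apply: le_trans (sqrt_cauchy_schwarz2 _ _ _ _) _.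
rewrite /U su (negbTE sv) eq_sym (negbTE uv) setU11 !in_setU1 (negbTE sv) (negbTE uv) /=.
rewrite (negbTE vS) /= !sqr_sqrtr ?sumsq_ge0 //.
rewrite ler_pM ?sqrtr_ge0 // ler_sqrt ?sumsq_ge0 //.
  by rewrite big_bool !big_pred1_eq.
rewrite -big_split /= le_eqVlt; apply/orP; left; apply/eqP.
by apply: eq_bigr => x _; rewrite big_bool !big_pred1_eq.
Qed.

(** Per orbit, this bounds the trace of a product of 2 x 2 matrices by the product of their
    Hilbert-Schmidt norms; a fixed point keeps its exact trace. Summing out one variable at a time
    avoids decomposing [s] into cycles. *)
Lemma cycle_sum_le :
  \sum_(g : {ffun E -> bool}) \prod_e B e (g e) (g (s e)) <=
  \prod_e (if s e == e then \sum_b B e b b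
           else Num.sqrt (\sum_x \sum_y B e x y ^+ 2)).
Proof.
(* The sum still ranges over all [g], although the product no longer depends on [g e] for [e] in
   [S]; the power of 1/2 removes this multiplicity. *)
pose Z (S : {set E}) := (2^-1) ^+ #|S| * \sum_(g : {ffun E -> bool}) \prod_e U S e (g e) (g (s e)).
have Zstep (S : {set E}) v : v \notin S -> Z S <= Z (v |: S).
  move=> vS; rewrite /Z cardsU1 vS exprS mulrC (sum_upd v).
  rewrite [2^-1 * 2^-1 ^+ _]mulrC -[leRHS]mulrA [leLHS]mulrC.
  rewrite ler_wpM2l ?exprn_ge0 ?invr_ge0 ?ler0n //.
  by rewrite ler_wpM2l ?invr_ge0 ?ler0n // ler_sum // => g _; apply: step.
have Z0 (S : {set E}) : Z set0 <= Z S.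
  elim: {S}#|S| {-2}S (erefl #|S|) => [|k IH] S; first by move/cards0_eq->.
  move=> cS; have /card_gt0P[v vS] : (0 < #|S|)%N by rewrite cS.
  rewrite -(setD1K vS); apply: le_trans (Zstep _ _ _); last by rewrite setD11.
  by apply: IH; move: cS; rewrite (cardsD1 v) vS => -[].
have U0 : \sum_(g : {ffun E -> bool}) \prod_e B e (g e) (g (s e)) = Z set0.
  rewrite /Z cards0 expr0 mul1r; apply: eq_bigr => g _; apply: eq_bigr => e _.
  rewrite /U; case: eqP => [->|_]; rewrite !inE //=.
  by rewrite !big_pred1_eq sqrtr_sqr ger0_norm.
rewrite U0; apply: le_trans (Z0 setT) _.
have ZT (g : {ffun E -> bool}) : \prod_e U setT e (g e) (g (s e)) =
    \prod_e (if s e == e then \sum_b B e b b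
             else Num.sqrt (\sum_x \sum_y B e x y ^+ 2)).
  by apply: eq_bigr => e _; rewrite /U !in_setT.
rewrite /Z (eq_bigr _ (fun g : {ffun E -> bool} => fun=> ZT g)).
rewrite sumr_const card_ffun card_bool cardsT -[X in _ * X]mulr_natl mulrA natrX.
by rewrite -exprMn mulVf ?expr1n ?mul1r // pnatr_eq0.
Qed.
End CycleSum.

(** * Action of user permutations on edges and graphs; counting *)

Section EdgeCombinatorics.
Import boot.fintype boot.finset.
Variables n m : nat.
Implicit Types (s t : {perm 'I_n}) (S : {set 'I_n}) (e : edge n m) (g : graph n m).

Lemma relabel_edgeM s t e :
  relabel_edge (s * t)%g e = relabel_edge t (relabel_edge s e).
Proof.
case: e => [u|[i a]] /=; last by rewrite permM.
congr inl; apply: val_inj => /=; rewrite -imset_comp.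
by apply: eq_imset => i /=; rewrite permM.
Qed.

Lemma relabel_edge1 e : relabel_edge 1%g e = e.
Proof.
case: e => [u|[i a]] /=; last by rewrite perm1.
congr inl; apply: val_inj => /=; rewrite -[RHS]imset_id.
by apply: eq_imset => i /=; rewrite perm1.
Qed.

Lemma relabel_edgeK s : cancel (@relabel_edge n m s) (relabel_edge s^-1%g).
Proof. by move=> e; rewrite -relabel_edgeM mulgV relabel_edge1. Qed.

Definition edge_perm s : {perm edge n m} := perm (can_inj (relabel_edgeK s)).

(** When [Pistar] is [s], [pullback s] recovers [G2] from [G2']. *)
Definition pullback s g : graph n m := [ffun e => g (relabel_edge s e)].

Lemma relabel_graphE s g : relabel_graph s g = pullback s^-1%g g.
Proof. by []. Qed.

Lemma pullbackM s t g : pullback s (pullback t g) = pullback (s * t)%g g.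
Proof. by apply/ffunP=> e; rewrite !ffunE relabel_edgeM. Qed.

Lemma pullback1 g : pullback 1%g g = g.
Proof. by apply/ffunP=> e; rewrite ffunE relabel_edge1. Qed.

Lemma pullbackK s : cancel (pullback s) (pullback s^-1%g).
Proof. by move=> g; rewrite pullbackM mulVg pullback1. Qed.

Definition moved_users s : {set 'I_n} := [set i | s i != i].
Definition moved_edges s : {set edge n m} := [set e | relabel_edge s e != e].

Definition touches S e : bool :=
  match e with inl u => ~~ [disjoint val u & S] | inr (i, _) => i \in S end.
Definition touching S : {set edge n m} := [set e | touches S e].

Lemma mem_touching S e : (e \in touching S) = touches S e.
Proof. by rewrite inE. Qed.

(** With k = |S|, there are C(n,2) - C(n-k,2) user pairs and k m attribute edges. The identity is
    doubled and rearranged so as to hold in [nat] without division or truncated subtraction. *)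
Lemma card_touching S :
  (2 * #|touching S| + #|S| * #|S|.+1 = 2 * #|S| * (n + m))%N.
Proof.
have cS : (#|S| + #|~: S| = n)%N by rewrite cardsC card_ord.
have all_pairs : #|{: user_pair n}| = 'C(n, 2).
  by rewrite card_sig -[n in RHS]card_ord -card_draws; apply: eq_card => A; rewrite !inE.
have disj : #|[pred u : user_pair n | [disjoint val u & S]]| = 'C(n - #|S|, 2).
  have -> : (n - #|S| = #|~: S|)%N by lia.
  rewrite -cards_draws -(card_imset _ val_inj).
  apply: eq_card => A; rewrite inE; apply/imsetP/andP => [[u]|[AS cA]].
    by rewrite inE disjoints_subset => uS ->; split=> //; apply: (valP u).
  by exists (exist _ A cA); rewrite ?inE //= disjoints_subset.
have meet : #|[pred u : user_pair n | ~~ [disjoint val u & S]]| =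
    ('C(n, 2) - 'C(n - #|S|, 2))%N.
  rewrite -all_pairs -disj -(cardC [pred u : user_pair n | [disjoint val u & S]]) addKn.
  by apply: eq_card.
have attr : #|[pred x : 'I_n * 'I_m | x.1 \in S]| = (#|S| * m)%N.
  rewrite -[m in RHS]card_ord -cardX; apply: eq_card => x.
  by rewrite !inE andbT.
have -> : #|touching S| = ('C(n, 2) - 'C(n - #|S|, 2) + #|S| * m)%N.
  rewrite -meet -attr -!sum1_card big_sumType /=.
  congr (_ + _)%N; apply: eq_bigl => x; rewrite !inE //.
  by case: x.
have kn : (#|S| <= n)%N by lia.
have b2 k : (2 * 'C(k, 2) + k = k * k)%N.
  case: k => // k; rewrite bin2 mul2n -[in LHS](odd_double_half (k.+1 * k)).
  rewrite /= oddM /= andNb add0n doubleK /=.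
  have := odd_double_half (k.+1 * k); rewrite oddM /= andNb add0n => ->; lia.
have := b2 n; have := b2 (n - #|S|)%N.
have : ('C(n - #|S|, 2) <= 'C(n, 2))%N by apply: leq_bin2l; rewrite leq_subr.
move: ('C(_, _)) ('C(_, _)) kn => x y kn xy hx hy; nia.
Qed.

Lemma moved_edges_touch s : moved_edges s \subset touching (moved_users s).
Proof.
apply/subsetP=> e; rewrite mem_touching inE; apply: contraR.
case: e => [u|[i a]] /=; rewrite ?negbK => h; last first.
  by move: h; rewrite inE negbK => /eqP->.
apply/eqP; congr inl; apply: val_inj => /=; rewrite -[RHS]imset_id.
apply: eq_in_imset => i iu /=; apply/eqP; apply: contraTT h => si.
by apply/pred0Pn; exists i; rewrite /= iu inE.
Qed.

(** A fixed edge with a moved endpoint i is not an attribute edge, and as a fixed pair it also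
    contains s i, hence equals {i, s i}. So the image of i -> {i, s i} on the moved users contains
    all these edges. *)
Lemma card_fixed_touching s :
  (#|touching (moved_users s) :\: moved_edges s| <= #|moved_users s|)%N.
Proof.
pose ends (e : edge n m) : {set 'I_n} := if e is inl u then val u else set0.
set F := _ :\: _.
have FE e : e \in F -> exists2 u, e = inl u &
    exists2 i, i \in moved_users s & val u = [set i; s i].
  rewrite !inE negbK => /andP[]; case: e => [u|[i a]] /=; last first.
    by rewrite inE => /eqP[->]; rewrite eqxx.
  move=> /eqP[fu] /pred0Pn[i /andP[/= iu iS]]; exists u => //; exists i => //.
  have su : s @: val u = val u by rewrite -[in RHS]fu.
  have siu : s i \in val u by rewrite -su imset_f.
  apply/esym/eqP; rewrite eqEcard (eqP (valP u)) subUset !sub1set iu siu /=.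
  by rewrite cards2 eq_sym; move: iS; rewrite inE => ->.
rewrite -(@card_in_imset _ _ ends F); last first.
  by move=> e f /FE[u -> _] /FE[v -> _] /= /val_inj->.
apply: leq_trans (leq_imset_card (fun i => [set i; s i]) (moved_users s)).
apply: subset_leq_card; apply/subsetP=> A /imsetP[e eF ->].
by case: (FE e eF) => u -> [i iS /= ->]; apply: imset_f.
Qed.

Lemma card_touching_le s :
  (#|touching (moved_users s)| <= #|moved_edges s| + #|moved_users s|)%N.
Proof.
rewrite -(cardsID (moved_edges s) (touching _)) (setIidPr (moved_edges_touch s)).
by rewrite leq_add2l card_fixed_touching.
Qed.

Definition common (A : {set edge n m}) g1 g2 : nat :=
  #|[set e in A | g1 e && g2 e]|.

Lemma common_touching_le s g1 g2 :
  (common (touching (moved_users s)) g1 g2 <=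
   common (moved_edges s) g1 g2 + #|moved_users s|)%N.
Proof.
apply: leq_trans (leq_add (leqnn _) (card_fixed_touching s)).
apply: leq_trans (leq_card_setU _ _); apply: subset_leq_card.
by apply/subsetP=> e; rewrite !inE => /andP[-> ->]; rewrite !andbT orbN.
Qed.

(** Choose the k moved users, then a permutation of them: at most C(n,k) k!, a falling factorial. *)
Lemma card_moved_users k :
  (#|[set s : {perm 'I_n} | #|moved_users s| == k]| <= n ^ k)%N.
Proof.
apply: (@leq_trans (n ^_ k)); last first.
  rewrite ffact_prod -[k in (_ ^ k)%N]card_ord -prod_nat_const.
  by rewrite leq_prod // => i _; apply: leq_subr.
rewrite -bin_ffact -[n in 'C(n, _)]card_ord -card_draws -sum_nat_const.
rewrite -sum1_card.
rewrite (partition_big moved_users (mem [set A : {set 'I_n} | #|A| == k])) /=; last first.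
  by move=> s; rewrite !inE.
apply: leq_sum => A; rewrite inE => /eqP cA.
rewrite sum1_card -cA -card_perm; apply: subset_leq_card.
apply/subsetP=> s /andP[_ /eqP sA]; apply/subsetP=> i si.
by rewrite -sA inE.
Qed.

Lemma moved_users_eq0 s : (#|moved_users s| == 0)%N = (s == 1%g).
Proof.
rewrite cards_eq0; apply/eqP/eqP => [s0|->]; last first.
  by apply/setP=> i; rewrite !inE perm1 eqxx.
apply/permP=> i; rewrite perm1; apply/eqP; apply: contraT => si.
by have := in_set0 i; rewrite -s0 inE si.
Qed.
End EdgeCombinatorics.

(** * Likelihoods, MAP errors and the transfer matrix *)

Section Likelihood.
Import boot.fintype boot.finset.
Variables (R : realType) (n m : nat) (p : bool -> bool -> R).
Hypothesis p_prob : prob_vector p.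
Implicit Types (s : {perm 'I_n}) (g : graph n m) (w : outcome n m)
  (h : graph n m * graph n m).

Definition likelihood g1 g2 : R := \prod_e p (g1 e) (g2 e).

Lemma prob_ge0 a b : 0 <= p a b. Proof. by case: p_prob. Qed.

Lemma prob_sum : p true true + p true false + p false true + p false false = 1.
Proof. by case: p_prob => _; rewrite !big_bool /= addrA. Qed.

Lemma likelihood_ge0 g1 g2 : 0 <= likelihood g1 g2.
Proof. by apply: prodr_ge0 => e _; apply: prob_ge0. Qed.

Let N : R := #|{: {perm 'I_n}}|%:R.

Lemma massE w : mass p p w = likelihood (G1 w) (G2 w) / N.
Proof. by congr (_ / _); apply: eq_bigr => -[]. Qed.

Let N_gt0 : 0 < N.
Proof. by rewrite ltr0n; apply/card_gt0P; exists 1%g. Qed.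

Lemma mass_ge0 w : 0 <= mass p p w.
Proof. by rewrite massE divr_ge0 ?likelihood_ge0 ?(ltW N_gt0). Qed.

(** The observation and the permutation determine [G2], so the event is a single outcome. *)
Lemma Pr_jointE g1 g2' s :
  Pr p p (fun w => [&& Pistar w == s, G1 w == g1 & G2' w == g2']) =
  likelihood g1 (pullback s g2') / N.
Proof.
rewrite /Pr (big_pred1 (g1, pullback s g2', s)) ?massE // => -[[f1 f2] t] /=.
rewrite /Pistar /G1 /G2' /G2 /= relabel_graphE.
apply/and3P/eqP => [[/eqP-> /eqP-> /eqP<-]|[-> -> ->]].
  by rewrite pullbackM mulgV pullback1.
by rewrite pullbackM mulVg pullback1 !eqxx.
Qed.

Lemma sum_outcome (P : pred (graph n m * graph n m)) :
  \sum_(w : outcome n m | P w.1) mass p p w =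
  \sum_(h | P h) likelihood h.1 h.2.
Proof.
rewrite (eq_bigl (fun w : outcome n m => P w.1 && true)); last by move=> w; rewrite andbT.
rewrite (eq_bigr (fun w : outcome n m => likelihood w.1.1 w.1.2 / N)); last first.
  by move=> w _; rewrite massE.
rewrite -(pair_big P xpredT (fun h (_ : {perm 'I_n}) => likelihood h.1 h.2 / N)) /=.
apply: eq_bigr => h _; rewrite sumr_const -[_ *+ _]mulr_natr divfK //.
by rewrite (gt_eqF N_gt0).
Qed.

(** Here [s] is an estimate relative to the truth, which is the identity. Ties are included, since a
    MAP estimator may break them either way. *)
Definition confusable h s : bool :=
  (s != 1%g) && (likelihood h.1 h.2 <= likelihood h.1 (pullback s h.2)).

(** A wrong estimate makes [est * Pistar^-1] confusable: pulling [G2] back along it is pulling [G2']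
    back along the estimate. *)
Lemma map_error_le (est : estimator n m) : is_MAP p p est ->
  error_prob p p est <=
  \sum_(h | [exists s, confusable h s]) likelihood h.1 h.2.
Proof.
move=> MAP; rewrite -sum_outcome /error_prob /Pr big_mkcond [leRHS]big_mkcond /=.
apply: ler_sum => w _; case: ifPn => [err|_]; last by case: ifP => _ //; apply: mass_ge0.
(* Outcomes of mass 0 contribute nothing; positive mass makes the denominator of the posterior
   positive, so that it cancels. *)
case: ifPn => // nconf; move: (mass_ge0 w); rewrite le_eqVlt => /orP[/eqP<-//|w0].
case/existsP: nconf; exists (est (G1 w) (G2' w) * (Pistar w)^-1)%g.
apply/andP; split; first by apply: contra err => /eqP/eqP; rewrite -eq_mulgV1.
have := MAP (G1 w) (G2' w) (Pistar w).
rewrite /posterior !Pr_jointE ler_pM2r; last first.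
  rewrite invr_gt0; apply: lt_le_trans w0 _; rewrite /Pr (bigD1 w) ?eqxx //=.
  by rewrite lerDl sumr_ge0 // => ? _; apply: mass_ge0.
rewrite ler_pM2r ?invr_gt0 //.
by rewrite /G2' relabel_graphE !pullbackM mulgV pullback1.
Qed.

Lemma sum_graph_pairs (F : edge n m -> bool -> bool -> R) :
  \sum_(h : graph n m * graph n m) \prod_e F e (h.1 e) (h.2 e) = \prod_e \sum_a \sum_b F e a b.
Proof.
rewrite -(pair_big xpredT xpredT (fun g1 g2 : graph n m => \prod_e F e (g1 e) (g2 e))) /=.
rewrite (bigA_distr_bigA (fun e a => \sum_b F e a b)) /=.
by apply: eq_bigr => g1 _; rewrite (bigA_distr_bigA (fun e b => F e (g1 e) b)).
Qed.

Lemma sum_graph_left (F : graph n m -> edge n m -> bool -> R) :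
  \sum_(h : graph n m * graph n m) \prod_e F h.2 e (h.1 e) = \sum_g \prod_e \sum_a F g e a.
Proof.
rewrite -(pair_big xpredT xpredT (fun g1 g2 : graph n m => \prod_e F g2 e (g1 e))) exchange_big /=.
by apply: eq_bigr => g _; rewrite (bigA_distr_bigA (fun e a => F g e a)).
Qed.

Definition sqrt_likelihood g1 g2 : R := \prod_e Num.sqrt (p (g1 e) (g2 e)).

Lemma sqrt_likelihood_ge0 g1 g2 : 0 <= sqrt_likelihood g1 g2.
Proof. by apply: prodr_ge0 => e _; apply: sqrtr_ge0. Qed.

Lemma sqr_sqrt_likelihood g1 g2 : sqrt_likelihood g1 g2 ^+ 2 = likelihood g1 g2.
Proof.
by rewrite -prodrXl; apply: eq_bigr => e _; rewrite sqr_sqrtr // prob_ge0.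
Qed.

(** If a <= b then a <= sqrt a * sqrt b: the Chernoff bound with exponent 1/2. *)
Lemma confusable_le h s : confusable h s ->
  likelihood h.1 h.2 <=
  sqrt_likelihood h.1 h.2 * sqrt_likelihood h.1 (pullback s h.2).
Proof.
move=> /andP[_]; rewrite -!sqr_sqrt_likelihood => le2.
rewrite expr2 ler_wpM2l ?sqrt_likelihood_ge0 //.
by rewrite -(@ler_pXn2r _ 2) ?nnegrE ?sqrt_likelihood_ge0.
Qed.

Local Notation r a b := (Num.sqrt (p a b)).

(* Squared Hilbert-Schmidt norm of the transfer matrix along an orbit of edges,
   with weight y on common edges. *)
Definition transfer_norm2 (y : R) : R :=
  (y * p true true + p false true) ^+ 2 + (p true false + p false false) ^+ 2
  + 2 * (y * (r true true * r true false) + r false true * r false false) ^+ 2.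

Let sqr_r a b : r a b * r a b = p a b.
Proof. by rewrite -expr2 sqr_sqrtr // prob_ge0. Qed.

(** For fixed [G2 = g], summing out [G1] edge by edge leaves factors depending only on [g e] and
    [g (s e)], so [cycle_sum_le] applies to the edge permutation. Fixed edges carry no weight and
    have trace equal to the total mass 1. *)
Lemma tilted_sum_le s (y : R) : 1 <= y ->
  \sum_(h : graph n m * graph n m)
     sqrt_likelihood h.1 h.2 * sqrt_likelihood h.1 (pullback s h.2)
     * y ^+ common (moved_edges m s) h.1 h.2
  <= Num.sqrt (transfer_norm2 y) ^+ #|moved_edges m s|.
Proof.
move=> y1; have y0 : 0 <= y by apply: le_trans y1.
pose c (e : edge n m) a b : R := if relabel_edge s e != e then y ^+ (a && b) else 1.
pose B (e : edge n m) b b' := \sum_a r a b * r a b' * c e a b.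
have c_ge0 e a b : 0 <= c e a b by rewrite /c; case: ifP => // _; rewrite exprn_ge0.
have B_ge0 e b b' : 0 <= B e b b'.
  by apply: sumr_ge0 => a _; rewrite !mulr_ge0 ?sqrtr_ge0.
have -> : \sum_(h : graph n m * graph n m)
     sqrt_likelihood h.1 h.2 * sqrt_likelihood h.1 (pullback s h.2)
     * y ^+ common (moved_edges m s) h.1 h.2 =
     \sum_(g : graph n m) \prod_e B e (g e) (g (edge_perm m s e)).
  rewrite -(sum_graph_left (fun (g : graph n m) e a =>
    r a (g e) * r a (g (edge_perm m s e)) * c e a (g e))).
  apply: eq_bigr => h _; rewrite !big_split /=; congr (_ * _ * _).
    by apply: eq_bigr => e _; rewrite permE ffunE.
  rewrite /common -prodr_const big_mkcond /=; apply: eq_bigr => e _.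
  by rewrite !inE /c; case: (relabel_edge s e != e); case: (h.1 e && h.2 e).
apply: le_trans (cycle_sum_le _ B_ge0) _.
rewrite -prodr_const [leRHS]big_mkcond /=; apply: ler_prod => e _.
rewrite permE inE; case: eqP => [fe|ne] /=.
  rewrite sumr_ge0 //= /B /c fe eqxx /= big_bool !big_bool /= !mulr1 !sqr_r.
  by have := prob_sum; lra.
rewrite sqrtr_ge0 ler_sqrt; last first.
  by rewrite !addr_ge0 ?sqr_ge0 // mulr_ge0 ?sqr_ge0.
rewrite /B /c; move/eqP: ne => -> /=; rewrite !big_bool /= !mulr1 !sqr_r /transfer_norm2.
rewrite -subr_ge0.
have uv : 0 <= r true true * r true false by rewrite mulr_ge0 ?sqrtr_ge0.
have wz : 0 <= r false true * r false false by rewrite mulr_ge0 ?sqrtr_ge0.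
move: uv wz; rewrite [r true false * r true true]mulrC [r false false * r false true]mulrC.
move: (r true true * _) (r false true * _) => U V U0 V0.
(* The weight [y] depends on the row index only, so the off-diagonal entries are yU + V and U + V;
   [transfer_norm2] counts the larger one twice. *)
rewrite (_ : _ - _ = (y * U + V) ^+ 2 - (U + V) ^+ 2); last by ring.
rewrite subr_ge0 ler_pXn2r ?nnegrE ?addr_ge0 ?mulr_ge0 //.
by rewrite lerD2r ler_peMl.
Qed.

(** Lagrange's identity for the two columns of the matrix of square roots of [p], after writing 1 as
    the square of the total mass. *)
Lemma transfer_norm2_1 : transfer_norm2 1 = 1 - 2 * psi p.
Proof.
apply/eqP; rewrite eq_sym subr_eq eq_sym; apply/eqP.
rewrite -[RHS](expr1n _ 2) -[in RHS]prob_sum /transfer_norm2 /psi !sqrtrM ?prob_ge0 //.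
move: (sqr_r true true) (sqr_r true false) (sqr_r false true) (sqr_r false false).
move: (r true true) (r true false) (r false true) (r false false) => x y z t.
move: (p true true) (p true false) (p false true) (p false false) => a b c d.
by move=> <- <- <- <-; ring.
Qed.

Lemma psi_ge0 : 0 <= psi p. Proof. exact: sqr_ge0. Qed.

Lemma psi_le1 : 2 * psi p <= 1.
Proof.
rewrite -subr_ge0 -transfer_norm2_1.
by rewrite !addr_ge0 ?sqr_ge0 // mulr_ge0 ?sqr_ge0.
Qed.

(** Beyond [transfer_norm2 1], which is at most 1, every monomial has a factor [p true true] or is a
    multiple of the product of the four square roots, which is at most [d * p true true]. Powers of
    y are bounded by y^2. *)
Lemma transfer_norm2_le (y d : R) : 1 <= y -> 0 <= d ->
  Num.sqrt (p true false * p false true) <=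
    d * Num.sqrt (p true true * p false false) ->
  transfer_norm2 y <=
  1 + y ^+ 2 * (4 * p true true * (p true true + p true false + p false true + d)).
Proof.
move=> y1 d0 hd.
have yy : y <= y ^+ 2 by rewrite expr2 ler_peMl // (le_trans _ y1).
have y0 : 0 <= y by apply: le_trans y1.
have base : transfer_norm2 1 <= 1 by rewrite transfer_norm2_1 gerBl mulr_ge0 ?psi_ge0.
have p00_le1 : p false false <= 1.
  have := prob_sum; have := prob_ge0 true true.
  by have := prob_ge0 true false; have := prob_ge0 false true; lra.
move: hd base; rewrite !sqrtrM ?prob_ge0 // /transfer_norm2.
have := prob_ge0 false true; have := prob_ge0 true false; have := prob_ge0 true true; move: p00_le1.
have := sqrtr_ge0 (p true true); have := sqrtr_ge0 (p true false).
have := sqrtr_ge0 (p false true); have := sqrtr_ge0 (p false false).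
move: (sqr_r true true) (sqr_r true false) (sqr_r false true) (sqr_r false false).
move: (r true true) (r true false) (r false true) (r false false) => u v w z.
move: (p true true) (p true false) (p false true) (p false false) => a b c e.
move=> ua vb wc ze z0 w0 v0 u0 e1 a0 b0 c0 hd base.
set X := u * v * (w * z).
have cross : X <= a * d.
  rewrite (_ : X = (u * z) * (v * w)); last by rewrite /X; ring.
  apply: (@le_trans _ _ ((u * z) * (d * (u * z)))); first by rewrite ler_wpM2l ?mulr_ge0.
  rewrite [leLHS](_ : _ = a * d * e); last by rewrite -ua -ze; ring.
  by rewrite ler_piMr // mulr_ge0.
have X0 : 0 <= X by rewrite /X !mulr_ge0.
have Y1 : 1 <= y ^+ 2 by rewrite (le_trans y1).
have Y0 : 0 <= y ^+ 2 - y + 1 by lra.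
rewrite -subr_ge0;
apply: le_trans (_ : 1 - ((1 * a + c) ^+ 2 + (b + e) ^+ 2
  + 2 * (1 * (u * v) + w * z) ^+ 2) <= _).
  by rewrite subr_ge0.
rewrite -subr_ge0 (_ : _ - _ = y ^+ 2 * (3 * (a * a) + 2 * (a * b) + 2 * (a * c)
    + 4 * (a * d - X)) + (a * a + 2 * (a * b)) + (y ^+ 2 - y + 1) * (2 * (a * c) + 4 * X)).
  have ? := mulr_ge0 a0 a0; have ? := mulr_ge0 a0 b0; have ? := mulr_ge0 a0 c0.
  have t1 : 0 <= 3 * (a * a) + 2 * (a * b) + 2 * (a * c) + 4 * (a * d - X) by lra.
  have t2 : 0 <= a * a + 2 * (a * b) by lra.
  have t3 : 0 <= 2 * (a * c) + 4 * X by lra.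
  by apply: addr_ge0; [apply: addr_ge0 => //|]; apply: mulr_ge0 => //; rewrite sqr_ge0.
by rewrite /X -ua -vb -wc -ze; ring.
Qed.
End Likelihood.

(** * Chernoff and union bounds for the error probability *)

Section UnionBound.
Import boot.fintype boot.finset.
Variables (R : realType) (n m : nat) (p : bool -> bool -> R).
Hypothesis p_prob : prob_vector p.
Implicit Types (s : {perm 'I_n}) (S : {set 'I_n}).
Local Notation gpair := (graph n m * graph n m)%type.

Lemma expR1_ge2 : 2 <= expR 1 :> R.
Proof. by have := @expR_ge1Dx R 1; lra. Qed.

(** Chernoff bound with weight 1/e per common edge: each edge of [A] has mean weight 1 - (1 - 1/e)
    p11 <= 1 - p11 / 2 <= exp(- p11 / 2). *)
Lemma common_lower_tail (A : {set edge n m}) (K : R) :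
  \sum_(h : gpair | (common A h.1 h.2)%:R <= K) likelihood p h.1 h.2 <=
  expR (K - #|A|%:R * (p true true / 2)).
Proof.
pose c (e : edge n m) a b : R := if e \in A then expR (- 1) ^+ (a && b) else 1.
have c_ge0 e a b : 0 <= c e a b by rewrite /c; case: ifP => // _; rewrite exprn_ge0 ?expR_ge0.
have lik_ge0 := likelihood_ge0 p_prob.
apply: (@le_trans _ _ (expR K * \sum_(h : gpair) \prod_e
  (p (h.1 e) (h.2 e) * c e (h.1 e) (h.2 e)))).
  rewrite big_mkcond mulr_sumr /=; apply: ler_sum => h _.
  rewrite big_split /=.
  have -> : \prod_i c i (h.1 i) (h.2 i) = expR (- (common A h.1 h.2)%:R).
    rewrite -mulrN1 expRM_natl /common -prodr_const [RHS]big_mkcond.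
    apply: eq_bigr => e _; rewrite inE /c; case: (e \in A) => //=.
    by case: (h.1 e && h.2 e).
  case: ifP => hK; last by rewrite !mulr_ge0 ?expR_ge0 ?lik_ge0.
  rewrite mulrCA -expRD ler_peMr ?lik_ge0 // -[leLHS]expR0 ler_expR; lra.
rewrite (sum_graph_pairs (fun e a b => p a b * c e a b)) expRD ler_wpM2l ?expR_ge0 //.
rewrite -mulrN expRM_natl -prodr_const [leRHS]big_mkcond /=.
apply: ler_prod => e _; rewrite !big_bool /= /c.
have [ps p0] := (prob_sum p_prob, prob_ge0 p_prob).
case: (e \in A) => /=; last by rewrite !mulr1 !addr_ge0 ?p0 //=; lra.
rewrite !expr0 !expr1 !mulr1 !addr_ge0 ?mulr_ge0 ?expR_ge0 ?p0 //=.
apply: le_trans (expR_ge1Dx _).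
have e2 : expR (-1) <= 2^-1 :> R by rewrite expRN lef_pV2 ?posrE ?expR_gt0 // expR1_ge2.
have := ler_wpM2l (p0 true true) e2; lra.
Qed.

(** [K k] is a threshold for the common edges touching k users. If the moved set is not small,
    either it touches at most [K k] of them, an event depending on the set alone and so summed over
    sets rather than permutations, or more than [K k - k] moved edges are common and the tilt by
    [expR B] pays for the last exponential factor. *)
Lemma error_union_bound (est : estimator n m) (small : pred nat) (K : nat -> R) (B : R) :
  0 <= B -> is_MAP p p est ->
  error_prob p p est <=
  \sum_(s : {perm 'I_n} | (s != 1%g) && small #|moved_users s|)
     Num.sqrt (transfer_norm2 p 1) ^+ #|moved_edges m s|
  + \sum_(S : {set 'I_n} | ~~ small #|S|)
     expR (K #|S| - #|touching m S|%:R * (p true true / 2))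
  + \sum_(s : {perm 'I_n} | (s != 1%g) && ~~ small #|moved_users s|)
     Num.sqrt (transfer_norm2 p (expR B)) ^+ #|moved_edges m s|
     * expR (- (B * (K #|moved_users s| - #|moved_users s|%:R))).
Proof.
move=> B0 MAP; apply: le_trans (map_error_le p_prob MAP) _.
have lik_ge0 := likelihood_ge0 p_prob; have sq_ge0 := sqrt_likelihood_ge0.
pose ratio s (h : gpair) := sqrt_likelihood p h.1 h.2 * sqrt_likelihood p h.1 (pullback s h.2).
have ratio_ge0 s h : 0 <= ratio s h by rewrite mulr_ge0 ?sq_ge0.
have eB : 1 <= expR B by rewrite -[leLHS]expR0 ler_expR.
apply: (@le_trans _ _ (\sum_(h : gpair) (
    \sum_(s : {perm 'I_n} | (s != 1%g) && small #|moved_users s|) ratio s h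
  + \sum_(S : {set 'I_n} | ~~ small #|S|)
     (if (common (touching m S) h.1 h.2)%:R <= K #|S| then likelihood p h.1 h.2 else 0)
  + \sum_(s : {perm 'I_n} | (s != 1%g) && ~~ small #|moved_users s|)
     ratio s h * expR B ^+ common (moved_edges m s) h.1 h.2
     * expR (- (B * (K #|moved_users s| - #|moved_users s|%:R)))))).
  rewrite big_mkcond; apply: ler_sum => h _.
  set X := \sum_(s | _) _; set Y := \sum_(S | _) _; set Z := \sum_(s | _) _.
  have X0 : 0 <= X by apply: sumr_ge0.
  have Y0 : 0 <= Y by apply: sumr_ge0 => S _; case: ifP.
  have Z0 : 0 <= Z.
    apply: sumr_ge0 => s _.
    by rewrite mulr_ge0 ?expR_ge0 // mulr_ge0 ?exprn_ge0 ?expR_ge0.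
  case: ifPn => [/existsP[s cs]|_]; last by rewrite !addr_ge0.
  have lr : likelihood p h.1 h.2 <= ratio s h by apply: confusable_le.
  have s1 : s != 1%g by case/andP: cs.
  have [sm|lg] := boolP (small #|moved_users s|).
    rewrite -addrA -[leLHS]addr0 lerD ?addr_ge0 // (le_trans lr) //.
    by rewrite /X (bigD1 s) ?s1 //= lerDl sumr_ge0.
  have [cK|cK] := leP (common (touching m (moved_users s)) h.1 h.2)%:R (K #|moved_users s|).
    rewrite -[leLHS]addr0 lerD // -[leLHS]add0r lerD //.
    rewrite /Y (bigD1 (moved_users s)) //= cK lerDl sumr_ge0 // => S _.
    by case: ifP.
  rewrite -[leLHS]add0r lerD ?addr_ge0 // /Z (bigD1 s) ?s1 //=.
  rewrite -[leLHS]addr0 lerD //; last first.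
    by apply: sumr_ge0 => t _; rewrite mulr_ge0 ?expR_ge0 // mulr_ge0 ?exprn_ge0 ?expR_ge0.
  rewrite (le_trans lr) // -mulrA ler_peMr // -expRM_natl -expRD -[leLHS]expR0 ler_expR.
  rewrite -[X in X - _]mulrC -mulrBr mulr_ge0 //.
  have := common_touching_le s h.1 h.2; rewrite -(ler_nat R) natrD; lra.
rewrite !big_split /= lerD // ?lerD //.
- rewrite exchange_big; apply: ler_sum => s _.
  apply: le_trans (@tilted_sum_le _ _ m _ p_prob s 1 (lexx _)); apply: ler_sum => h _.
  by rewrite expr1n mulr1.
- rewrite exchange_big; apply: ler_sum => S _; rewrite -big_mkcond.
  exact: common_lower_tail.
- rewrite exchange_big; apply: ler_sum => s _; rewrite -mulr_suml.
  by rewrite ler_wpM2r ?expR_ge0 // tilted_sum_le.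
Qed.

(** Grouping by the number k >= 1 of moved users gives at most n^k terms x^k, hence a geometric
    series of ratio at most 1/2. *)
Lemma sum_perm_le (x : R) : 0 <= x -> n%:R * x <= 2^-1 ->
  \sum_(s : {perm 'I_n} | s != 1%g) x ^+ #|moved_users s| <= 2 * (n%:R * x).
Proof.
move=> x0 nx; set r := n%:R * x.
have r0 : 0 <= r by rewrite mulr_ge0 ?ler0n.
have lt s : (#|moved_users s| < n.+1)%N by rewrite ltnS -[leqRHS]card_ord max_card.
rewrite (partition_big (fun s => Ordinal (lt s)) (fun k : 'I_n.+1 => k != ord0)) /=; last first.
  by move=> s; rewrite -moved_users_eq0.
apply: (@le_trans _ _ (\sum_(k < n.+1 | k != ord0) r ^+ k)).
  apply: ler_sum => k _.
  apply: (@le_trans _ _ (\sum_(s in [set s : {perm 'I_n} | #|moved_users s| == k]) x ^+ k)).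
    rewrite big_mkcond [leRHS]big_mkcond; apply: ler_sum => s _; rewrite inE.
    case: andP => [[_ /eqP <-]|_] /=; first by rewrite eqxx.
    by case: ifP => // _; rewrite exprn_ge0.
  rewrite sumr_const /r exprMn -[_ *+ _]mulr_natl ler_wpM2r ?exprn_ge0 //.
  by rewrite -natrX ler_nat card_moved_users.
have geo : \sum_(k < n) r ^+ k <= 2.
  have := subrX1 r n; have : 0 <= r ^+ n by rewrite exprn_ge0.
  have S0 : 0 <= \sum_(k < n) r ^+ k by apply: sumr_ge0 => k _; rewrite exprn_ge0.
  have := ler_wpM2r S0 nx; rewrite -/r; lra.
rewrite big_mkcond big_ord_recl /= add0r.
under eq_bigr => k _ do rewrite /bump /= add1n exprSr.
by rewrite -mulr_suml ler_wpM2r.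
Qed.
End UnionBound.

(** * Explicit error bounds for the MAP estimator *)

Section AchievabilityBounds.
Import boot.fintype boot.finset.
Variables (R : realType) (n m : nat) (p : bool -> bool -> R).
Hypothesis p_prob : prob_vector p.
Hypothesis n_gt0 : (0 < n)%N.
Implicit Types (s : {perm 'I_n}) (S : {set 'I_n}).
Local Notation nm := ((n + m)%:R : R).
Local Notation L := (ln (n%:R : R)).
Local Notation p11 := (p true true).

Let n0 : 0 < n%:R :> R. Proof. by rewrite ltr0n. Qed.

Lemma card_touchingR S :
  #|touching m S|%:R = #|S|%:R * (nm - (#|S|%:R + 1) / 2) :> R.
Proof.
have := card_touching m S; move/(congr1 (fun k : nat => k%:R : R)).
rewrite !natrD !natrM -(addn1 #|S|) !natrD; lra.
Qed.

Lemma card_le_nm S : #|S|%:R <= n%:R :> R.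
Proof. by rewrite ler_nat -[leqRHS]card_ord max_card. Qed.

Lemma card_moved_edges_ge s :
  #|moved_users s|%:R * (nm - (#|moved_users s|%:R + 3) / 2) <=
  #|moved_edges m s|%:R :> R.
Proof.
have := card_touching_le m s; rewrite -(ler_nat R) natrD card_touchingR; lra.
Qed.

(** Used where the base of the power is at least 1, so that the exponent has to be bounded above. *)
Lemma card_moved_edges_le s :
  #|moved_edges m s|%:R <= #|moved_users s|%:R * nm :> R.
Proof.
have := subset_leq_card (moved_edges_touch m s).
rewrite -(ler_nat R) card_touchingR => /le_trans; apply.
by rewrite ler_wpM2l ?ler0n // gerBl divr_ge0 // addr_ge0.
Qed.

(** Since sqrt(1 - 2 psi) <= exp(- psi), a permutation moving k users contributes at most x^k with x
    = exp(- om) / n, and [sum_perm_le] applies; om >= 1 ensures n x <= 1/2. *)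
Lemma sum_small_le (P : pred nat) (om : R) : 1 <= om ->
  (forall k : nat, (0 < k <= n)%N -> P k ->
     om <= psi p * (nm - (k%:R + 3) / 2) - L) ->
  \sum_(s : {perm 'I_n} | (s != 1%g) && P #|moved_users s|)
     Num.sqrt (transfer_norm2 p 1) ^+ #|moved_edges m s| <= 2 * expR (- om).
Proof.
move=> om1 omP; pose x := expR (- om - L).
have nx : n%:R * x = expR (- om).
  by rewrite /x expRD [expR (- L)]expRN lnK ?posrE // mulrCA divff ?mulr1 // gt_eqF.
have e1 : expR (- om) <= 2^-1.
  rewrite expRN lef_pV2 ?posrE ?expR_gt0 // (le_trans (expR1_ge2 R)) //.
  by rewrite ler_expR.
rewrite -nx; apply: le_trans (sum_perm_le _ _); rewrite ?expR_ge0 ?nx //.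
rewrite big_mkcondr; apply: ler_sum => s s1.
case: ifPn => [Ps|_]; last by rewrite exprn_ge0 ?expR_ge0.
set k := #|moved_users s| in Ps *.
have k0 : (0 < k)%N by rewrite lt0n moved_users_eq0.
have kn : (k <= n)%N by rewrite -[leqRHS]card_ord max_card.
have := omP k; rewrite k0 kn => /(_ isT Ps) hom.
have sq : Num.sqrt (transfer_norm2 p 1) <= expR (- psi p).
  rewrite -[leRHS]ger0_norm ?expR_ge0 // -sqrtr_sqr ler_sqrt ?sqr_ge0 //.
  rewrite transfer_norm2_1 // -expRM_natl (le_trans _ (expR_ge1Dx _)) //; lra.
apply: (@le_trans _ _ (expR (- psi p) ^+ #|moved_edges m s|)).
  by rewrite lerXn2r ?nnegrE ?sqrtr_ge0 ?expR_ge0.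
rewrite -!expRM_natl ler_expR.
have T := ler_wpM2l (psi_ge0 p) (card_moved_edges_ge s); rewrite -/k in T.
have := ler_wpM2l (ler0n R k) hom; lra.
Qed.

(** All sizes are treated as small. From k <= n + m, at least half of k (n + m) edges move, up to
    3k/2; the latter costs 3 psi / 2 <= 3/4 per user, covered by the final -1. *)
Lemma error_le_dense (est : estimator n m) (om : R) : is_MAP p p est ->
  1 <= om -> om <= (nm * psi p - 2 * L) / 2 - 1 ->
  error_prob p p est <= 2 * expR (- om).
Proof.
move=> MAP om1 omE.
apply: le_trans (@error_union_bound _ _ _ _ p_prob est xpredT (fun=> 0) 0 (lexx _) MAP) _.
rewrite [X in _ + X + _]big_pred0 // [X in _ + _ + X]big_pred0; last first.
  by move=> s; rewrite andbF.
rewrite !addr0; apply: (@sum_small_le xpredT) => // k /andP[_ kn] _.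
have psi2 := psi_le1 p_prob; have psi0 := psi_ge0 p.
have kn' : k%:R <= nm by rewrite ler_nat (leq_trans kn) ?leq_addr.
have := ler_wpM2l psi0 kn'; lra.
Qed.

Lemma error_le_sparse (est : estimator n m) (om d : R) : is_MAP p p est ->
  1 <= om -> om <= nm * psi p - L - psi p * (16 * (n%:R / L) + 3 / 2) ->
  32 <= L -> L <= nm * p11 -> 0 <= d ->
  Num.sqrt (p true false * p false true) <= d * Num.sqrt (p11 * p false false) ->
  expR 96 ^+ 2 * (4 * (p11 + p true false + p false true + d)) <= 2 ->
  error_prob p p est <= 2 * expR (- om) + expR (- n%:R) + 2 * expR (- L).
Proof.
move=> MAP om1 omE L32 Lam d0 hd hy.
pose small (k : nat) := k%:R * L <= 32 * n%:R.
pose K (k : nat) := k%:R * (nm * p11) / 16.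
have [L0 p110] : 0 < L /\ 0 <= p11 by split; [lra | exact: prob_ge0].
have B0 : 0 <= 96 :> R by [].
have psi0 := psi_ge0 p.
apply: le_trans (error_union_bound p_prob small K B0 MAP) _.
apply: lerD; first apply: lerD.
- apply: (@sum_small_le small) => // k _ kL.
  have kL' : k%:R <= 32 * (n%:R / L) by rewrite mulrA ler_pdivlMr.
  have := ler_wpM2l psi0 kL'; lra.
(* At least k (n + m) / 4 edges touch S, so the exponent is at most k (n + m) p11 (1/16 - 1/8) <= -
   k L / 16 <= - 2n, and the 2^n sets leave exp(- n). *)
- apply: (@le_trans _ _ (\sum_(S : {set 'I_n} | ~~ small #|S|) expR (- (2 * n%:R)))).
    apply: ler_sum => S; rewrite /small -ltNge => kL; rewrite ler_expR /K card_touchingR.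
    set k : R := #|S|%:R in kL *.
    have k0 : 0 <= k by rewrite ler0n.
    have kn : k <= n%:R by apply: card_le_nm.
    have nn : n%:R <= nm by rewrite ler_nat leq_addr.
    have n2 : 2 <= n%:R :> R.
      have n1 : -1 < n%:R - 1 :> R by rewrite -subr_gt0 opprK subrK.
      by have := le_ln1Dx n1; rewrite addrC subrK; lra.
    have D : k * (nm / 4) <= k * (nm - (k + 1) / 2) by rewrite ler_wpM2l //; lra.
    have := ler_wpM2r p110 D; have := ler_wpM2l k0 Lam; lra.
  apply: (@le_trans _ _ (\sum_(S : {set 'I_n}) expR (- (2 * n%:R)))).
    rewrite big_mkcond; apply: ler_sum => S _; case: ifP => // _; exact: expR_ge0.
  rewrite sumr_const -cardsT -powersetT card_powerset cardsT card_ord -[_ *+ _]mulr_natl natrX.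
  rewrite (_ : - (2 * n%:R) = n%:R * (- 1) + n%:R * (- 1)); last by ring.
  have -> : expR (- n%:R) = expR (- 1) ^+ n :> R by rewrite -mulrN1 expRM_natl.
  rewrite expRD !expRM_natl mulrA -exprMn.
  rewrite ler_piMl ?exprn_ge0 ?expR_ge0 // exprn_ile1 ?mulr_ge0 ?expR_ge0 //.
  by rewrite expRN ler_pdivrMr ?expR_gt0 // mul1r expR1_ge2.
(* The tilted base is at most exp(p11) and at most k (n + m) edges move, so the exponent is at most
   k (n + m) p11 (1 - 96/16) + 96 k <= k (96 - 5 L) <= - 2 k L, as 32 <= L. *)
pose x := expR (- L - L).
have nx : n%:R * x = expR (- L).
  by rewrite /x expRD {1}expRN lnK ?posrE // mulrA divff ?mul1r // gt_eqF.
have e1 : expR (- L) <= 2^-1.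
  rewrite expRN lef_pV2 ?posrE ?expR_gt0 // (le_trans (expR1_ge2 R)) //.
  rewrite ler_expR; lra.
rewrite -nx; apply: le_trans (sum_perm_le _ _); rewrite ?expR_ge0 ?nx //.
rewrite big_mkcondr; apply: ler_sum => s s1.
case: ifPn => [_|_]; last by rewrite exprn_ge0 ?expR_ge0.
set k := #|moved_users s|.
set y := expR 96 in hy *.
set eps := 4 * _ in hy.
have y1 : 1 <= y by rewrite -[leLHS]expR0 ler_expR.
have sq : Num.sqrt (transfer_norm2 p y) <= expR (p11).
  rewrite -[leRHS]ger0_norm ?expR_ge0 // -sqrtr_sqr ler_sqrt ?sqr_ge0 //.
  rewrite -expRM_natl; apply: le_trans (expR_ge1Dx _).
  apply: le_trans (transfer_norm2_le p_prob y1 d0 hd) _.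
  rewrite lerD2l (_ : _ * _ = p11 * (y ^+ 2 * eps)); last by rewrite /eps; ring.
  by rewrite mulrC ler_wpM2r.
apply: (@le_trans _ _ (expR p11 ^+ #|moved_edges m s| * expR (- (96 * (K k - k%:R))))).
  by rewrite ler_wpM2r ?expR_ge0 // lerXn2r ?nnegrE ?sqrtr_ge0 ?expR_ge0.
rewrite -!expRM_natl -expRD ler_expR.
have T := ler_wpM2r p110 (card_moved_edges_le s); rewrite -/k in T.
have k0 : 0 <= k%:R :> R by rewrite ler0n.
have kLam := ler_wpM2l k0 Lam; have kL := ler_wpM2l k0 L32; rewrite /K; lra.
Qed.
End AchievabilityBounds.

(** * Isolated users and the lower bound on the error *)

Section Converse.
Import boot.fintype boot.finset.
Variables (R : realType) (n m : nat) (p : bool -> bool -> R).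
Hypothesis p_prob : prob_vector p.
Implicit Types (i j : 'I_n) (w : outcome n m) (h : graph n m * graph n m).
Local Notation gpair := (graph n m * graph n m)%type.
Local Notation p11 := (p true true).

Definition isolated i h : bool := common (touching m [set i]) h.1 h.2 == 0%N.

Lemma common0P (A : {set edge n m}) (g1 g2 : graph n m) :
  reflect (forall e, e \in A -> ~~ (g1 e && g2 e)) (common A g1 g2 == 0%N).
Proof.
rewrite cards_eq0; apply: (iffP eqP) => [A0 e eA|A0].
  by apply/negP => ge; have := in_set0 e; rewrite -A0 inE eA ge.
by apply/setP=> e; rewrite !inE; case: (boolP (e \in A)) => // /A0/negbTE.
Qed.

(** The swap pairs each edge e with r e. Moved edges touch i or j, hence are not common; exchanging
    the [G2] labels of two such edges preserves the product of their weights, or replaces p10 p01 by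
    p11 p00. Squaring turns the likelihoods into products over these pairs. *)
Lemma swap_likelihood_ge i j h :
  p true false * p false true <= p11 * p false false ->
  isolated i h -> isolated j h ->
  likelihood p h.1 h.2 <= likelihood p h.1 (pullback (tperm i j) h.2).
Proof.
move=> pos /common0P isoi /common0P isoj.
have p0 := prob_ge0 p_prob; have lik0 := likelihood_ge0 p_prob.
set t := tperm i j; set r := @relabel_edge n m t.
have rK e : r (r e) = e by rewrite -[RHS](relabel_edgeK t) /t tpermV.
have noncommon e : r e != e -> ~~ (h.1 e && h.2 e).
  move=> re; have := subsetP (moved_edges_touch m t) e.
  rewrite inE => /(_ re); rewrite mem_touching => et.
  suff [ei|ej] : touches [set i] e \/ touches [set j] e.
  - by apply: isoi; rewrite mem_touching.
  - by apply: isoj; rewrite mem_touching.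
  have ij k : k \in moved_users t -> (k == i) || (k == j).
    by rewrite inE /t; case: tpermP => [->|->|_ _ /eqP//]; rewrite eqxx ?orbT.
  case: e {re} et => [u|[k a]] /=; last by move/ij; rewrite !inE => /orP.
  case/pred0Pn=> k /andP[/= ku /ij /orP[/eqP ki|/eqP kj]]; [left|right];
    by apply/pred0Pn; exists k; rewrite /= ku inE ?ki ?kj eqxx.
pose P e := p (h.1 e) (h.2 e); pose Q e := p (h.1 e) (h.2 (r e)).
have PQ e : P e * P (r e) <= Q e * Q (r e).
  rewrite /P /Q rK; have [->//|re] := eqVneq (r e) e.
  have := noncommon _ re; have := noncommon (r e); rewrite rK eq_sym => /(_ re).
  case: (h.1 e) (h.2 e) (h.1 (r e)) (h.2 (r e)) => [] [] [] [] //= _ _;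
    by rewrite ?(mulrC (p false false)) ?(mulrC (p false true)) // mulrC.
have sq (F : edge n m -> R) : (\prod_e F e) ^+ 2 = \prod_e (F e * F (r e)).
  rewrite big_split expr2 /=; congr (_ * _).
  by rewrite (reindex_inj (inv_inj rK)).
have -> : likelihood p h.1 (pullback t h.2) = \prod_e Q e.
  by apply: eq_bigr => e _; rewrite ffunE.
rewrite -(@ler_pXn2r _ 2) ?nnegrE ?lik0 ?prodr_ge0 //; last by move=> e _; apply: p0.
rewrite /likelihood !sq; apply: ler_prod => e _.
by rewrite mulr_ge0 ?p0 //=; apply: PQ.
Qed.

Definition isolated_pair h (ij : 'I_n * 'I_n) : bool :=
  [&& ij.1 != ij.2, isolated ij.1 h & isolated ij.2 h].

(* On a correct outcome, swapping two users that are isolated in the intersection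
   graph (in G2 and in Pistar) leaves the observation unchanged, does not decrease the mass
   and makes the estimator wrong; the original outcome can be recovered since its
   permutation is the estimate. *)
Lemma two_isolated_le (est : estimator n m) :
  p true false * p false true <= p11 * p false false ->
  \sum_(h : gpair | [exists ij, isolated_pair h ij]) likelihood p h.1 h.2 <=
  2 * error_prob p p est.
Proof.
move=> pos; have mass0 := mass_ge0 p_prob.
pose t h := if [pick ij | isolated_pair h ij] is Some ij then tperm ij.1 ij.2 else 1%g.
pose correct w := est (G1 w) (G2' w) == Pistar w.
pose D h := [exists ij, isolated_pair h ij].
pose Phi w : outcome n m := (G1 w, pullback (t w.1) (G2 w), (t w.1 * Pistar w)%g).
have tP h : D h -> exists ij, isolated_pair h ij /\ t h = tperm ij.1 ij.2.
  by rewrite /t; case: pickP => [ij hij _|no /existsP[ij]]; [exists ij | rewrite no].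
have obs w : G2' (Phi w) = G2' w.
  by rewrite /G2' /Phi /Pistar /G2 /= !relabel_graphE pullbackM invMg mulgKV.
have Phi_mass w : D w.1 -> mass p p w <= mass p p (Phi w).
  move=> /tP[ij [/and3P[_ isoi isoj] tE]].
  rewrite !massE ler_wpM2r ?invr_ge0 ?ler0n // /Phi /G1 /G2 /= tE.
  exact: swap_likelihood_ge.
have Phi_inj : {in [set w | D w.1 && correct w] &, injective Phi}.
  move=> w w'; rewrite !inE => /andP[_ /eqP cw] /andP[_ /eqP cw'] eqPhi.
  have e1 : G1 w = G1 w' by case: eqPhi.
  have e2 : G2' w = G2' w' by rewrite -obs eqPhi obs.
  have e3 : Pistar w = Pistar w' by rewrite -cw -cw' e1 e2.
  have e4 : G2 w = G2 w'.
    move: e2; rewrite /G2' e3 !relabel_graphE; exact: (can_inj (pullbackK _)).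
  case: w w' e1 e3 e4 {cw cw' eqPhi e2} => [[? ?] ?] [[? ?] ?].
  by rewrite /G1 /G2 /Pistar /= => -> -> ->.
(* Incorrect outcomes are counted by the error probability directly, correct ones through [Phi];
   hence the factor 2. *)
rewrite -(sum_outcome p D) (bigID correct) /= mulr_natl mulr2n.
apply: lerD; last first.
  rewrite /error_prob /Pr big_mkcond [leRHS]big_mkcond; apply: ler_sum => w _ /=.
  by rewrite /correct; case: (_ == _); rewrite ?andbF ?andbT //=; case: ifP.
apply: (@le_trans _ _ (\sum_(w in [set w | D w.1 && correct w]) mass p p (Phi w))).
  rewrite big_set /=; apply: ler_sum => w /andP[Dw _]; exact: Phi_mass.
rewrite -(big_imset (fun w => mass p p w) Phi_inj) /error_prob /Pr.
rewrite big_mkcond [leRHS]big_mkcond; apply: ler_sum => w _ /=.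
case: ifP => [/imsetP[v]|_]; last by case: ifP.
rewrite inE => /andP[Dv /eqP cv] ->; rewrite obs cv.
have [ij [/and3P[neq _ _] tE]] := tP _ Dv.
case: eqP => // /(congr1 (fun x => x * (Pistar v)^-1)%g) /eqP.
rewrite mulgV mulgK eq_sym tE => /eqP/permP/(_ ij.1).
by rewrite tpermL perm1 => eq; rewrite eq eqxx in neq.
Qed.

Lemma no_common_sum (A : {set edge n m}) :
  \sum_(h : gpair | common A h.1 h.2 == 0%N) likelihood p h.1 h.2 = (1 - p11) ^+ #|A|.
Proof.
pose c (e : edge n m) a b : R := ((e \in A) ==> ~~ (a && b))%:R.
transitivity (\sum_(h : gpair) \prod_e (p (h.1 e) (h.2 e) * c e (h.1 e) (h.2 e))).
  rewrite big_mkcond; apply: eq_bigr => h _; rewrite big_split /=.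
  case: common0P => [A0|A0].
    rewrite [X in _ * X]big1 ?mulr1 // => e _; rewrite /c.
    by case: (boolP (e \in A)) => //= /A0 ->.
  have /existsP[e ce] : [exists e, (e \in A) && (h.1 e && h.2 e)].
    apply: contra_notT A0 => /existsPn A0 e eA.
    by have := A0 e; rewrite eA.
  rewrite [X in _ * X](bigD1 e) //= /c; case/andP: ce => -> ->.
  by rewrite mul0r mulr0.
rewrite (sum_graph_pairs (fun e a b => p a b * c e a b)) -prodr_const [RHS]big_mkcond.
apply: eq_bigr => e _; rewrite !big_bool /= /c.
have := prob_sum p_prob; case: (e \in A) => /=; lra.
Qed.

(** Second moment method for the number X of isolated users, of mean mu. Two users share exactly one
    incident edge, so both are isolated with probability (1 - p11)^(2 (n + m - 1) - 1) = q^2 / (1 -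
    p11). *)
Lemma two_isolated_ge (q mu : R) : q = (1 - p11) ^+ (n + m).-1 -> mu = n%:R * q ->
  16 <= mu -> p11 <= 32^-1 ->
  2^-1 <= \sum_(h : gpair | [exists ij, isolated_pair h ij]) likelihood p h.1 h.2.
Proof.
move=> qE muE mu16 p32; have lik0 := likelihood_ge0 p_prob.
have p0 := prob_ge0 p_prob true true.
pose X h : R := \sum_i (isolated i h)%:R.
pose E (F : gpair -> R) := \sum_h likelihood p h.1 h.2 * F h.
have n_gt0 : (0 < n)%N.
  by rewrite lt0n; apply/eqP => n0; move: mu16; rewrite muE n0 mul0r; lra.
have card1 i : #|touching m [set i]| = (n + m).-1.
  by have := card_touching m [set i]; rewrite cards1; lia.
have card2 i j : i != j -> (#|touching m [set i; j]|.+1 = (n + m).-1 + (n + m).-1)%N.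
  by move=> ij; have := card_touching m [set i; j]; rewrite cards2 ij /=; lia.
have Eiso i : E (fun h => (isolated i h)%:R) = q.
  rewrite qE -(card1 i) -no_common_sum /E [RHS]big_mkcond; apply: eq_bigr => h _.
  by rewrite /isolated; case: (_ == _); rewrite ?mulr1 ?mulr0.
have q0 : 0 <= q by rewrite qE exprn_ge0 //; lra.
have Eiso2 i j : i != j -> E (fun h => (isolated i h)%:R * (isolated j h)%:R) <= q ^+ 2 / (1 - p11).
  move=> ij; rewrite ler_pdivlMr; last by lra.
  apply: (@le_trans _ _ ((1 - p11) ^+ #|touching m [set i; j]| * (1 - p11))); last first.
    by rewrite -exprSr (card2 _ _ ij) exprD qE expr2.
  rewrite ler_wpM2r //; first by lra.
  rewrite -no_common_sum /E [leRHS]big_mkcond; apply: ler_sum => h _.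
  rewrite -natrM mulnb; case: ifP => [_|h0].
    by case: (_ && _); rewrite ?mulr1 ?mulr0.
  suff -> : isolated i h && isolated j h = false by rewrite mulr0.
  apply: contraFF h0 => /andP[/common0P hi /common0P hj]; apply/common0P => e.
  rewrite mem_touching => et.
  suff [ei|ej] : touches [set i] e \/ touches [set j] e.
  - by apply: hi; rewrite mem_touching.
  - by apply: hj; rewrite mem_touching.
  case: e et => [u|[k a]] /=; last by rewrite !inE => /orP.
  case/pred0Pn=> k /andP[/= ku]; rewrite !inE => /orP[ki|kj]; [left|right];
    by apply/pred0Pn; exists k; rewrite /= ku inE.
have ED F G : E (fun h => F h + G h) = E F + E G.
  by rewrite /E -big_split; apply: eq_bigr => h _; rewrite mulrDr.
have EZ a F : E (fun h => a * F h) = a * E F.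
  by rewrite /E mulr_sumr; apply: eq_bigr => h _; rewrite mulrCA.
have Esum (F : 'I_n -> gpair -> R) : E (fun h => \sum_i F i h) = \sum_i E (F i).
  by rewrite /E exchange_big; apply: eq_bigr => h _; rewrite mulr_sumr.
have E1 : E (fun=> 1) = 1.
  have := no_common_sum set0; rewrite cards0 expr0 => no_edge.
  rewrite -[RHS]no_edge /E [RHS]big_mkcond; apply: eq_bigr => h _.
  by case: common0P => [_|[]]; rewrite ?mulr1 // => e; rewrite inE.
have EX : E X = mu.
  by rewrite /X Esum (eq_bigr (fun=> q)) // sumr_const card_ord -[_ *+ _]mulr_natl muE.
have EX2 : E (fun h => X h ^+ 2) <= mu + mu ^+ 2 / (1 - p11).
  have -> : E (fun h => X h ^+ 2) =
      \sum_i \sum_j E (fun h => (isolated i h)%:R * (isolated j h)%:R).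
    rewrite -(eq_bigr _ (fun i _ => Esum _)) -Esum; congr E; apply/funext => h.
    by rewrite /X expr2 mulr_suml; apply: eq_bigr => i _; rewrite mulr_sumr.
  have -> : mu + mu ^+ 2 / (1 - p11) = \sum_(i < n) (q + n%:R * (q ^+ 2 / (1 - p11))).
    by rewrite sumr_const card_ord -[_ *+ _]mulr_natl muE; ring.
  apply: ler_sum => i _; rewrite (bigD1 i) //= lerD //.
    rewrite -(Eiso i) le_eqVlt; apply/orP; left; apply/eqP; congr E; apply/funext => h.
    by rewrite -natrM mulnb andbb.
  have c0 : 0 <= q ^+ 2 / (1 - p11) by rewrite divr_ge0 ?sqr_ge0 //; lra.
  rewrite (_ : n%:R * _ = \sum_(j < n) q ^+ 2 / (1 - p11)); last first.
    by rewrite sumr_const card_ord mulr_natl.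
  rewrite big_mkcond; apply: ler_sum => j _; case: ifP => // ji.
  by apply: Eiso2; rewrite eq_sym ji.
pose D h := [exists ij, isolated_pair h ij].
(* Without an isolated pair X <= 1 <= mu / 2, so (X - mu)^2 >= mu^2 / 4. The square is expanded for
   linearity of the expectation. *)
have cheb h : mu ^+ 2 / 4 * (1 - (D h)%:R) <= X h ^+ 2 + ((- 2 * mu) * X h + mu ^+ 2 * 1).
  rewrite (_ : X h ^+ 2 + _ = (X h - mu) ^+ 2); last by ring.
  case: (boolP (D h)) => [_|nD]; first by rewrite subrr mulr0 sqr_ge0.
  have X1 : X h <= 1.
    have -> : X h = #|[pred i | isolated i h]|%:R.
      rewrite -sum1_card natr_sum big_mkcond; apply: eq_bigr => i _.
      by rewrite inE; case: ifP.
    rewrite (_ : 1 = 1%:R) // ler_nat leqNgt; apply/negP => /card_gt1P.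
    move=> [i [j [hi hj ij]]]; case/negP: nD; apply/existsP; exists (i, j).
    by apply/and3P; split.
  have mu8 : mu / 2 <= mu - X h by lra.
  rewrite subr0 mulr1 -[leRHS]sqrrN opprB (_ : mu ^+ 2 / 4 = (mu / 2) ^+ 2); last by field.
  rewrite ler_pXn2r ?nnegrE //; lra.
have Ele F G : (forall h, F h <= G h) -> E F <= E G.
  by move=> FG; apply: ler_sum => h _; rewrite ler_wpM2l.
have := Ele _ _ cheb; rewrite EZ.
pose S := \sum_(h : gpair | D h) likelihood p h.1 h.2.
rewrite -/D -/S.
have SE : S = E (fun h => (D h)%:R).
  rewrite /S big_mkcond; apply: eq_bigr => h _.
  by case: (D h); rewrite ?mulr1 ?mulr0.
have -> : E (fun h => 1 - (D h)%:R) = 1 - S.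
  rewrite SE -[X in _ = X - _]E1 -[X in _ = _ + X]mulN1r -EZ -ED.
  by congr E; apply/funext => h; ring.
rewrite !ED !EZ EX E1 => ineq.
(* The variance is at most mu^2 (1/16 + 1/31), so there is no isolated pair with probability at most
   1/4 + 4/31 < 1/2. *)
have muE2 : mu ^+ 2 / (1 - p11) <= mu ^+ 2 * (32 / 31).
  rewrite ler_wpM2l ?sqr_ge0 // -[32 / 31]invrK lef_pV2 ?posrE //; lra.
have mu2 : 16 * mu <= mu ^+ 2 by rewrite expr2 ler_wpM2r //; lra.
rewrite leNgt; apply/negP => S2.
have := @ltr_pM2l _ (mu ^+ 2 / 4); rewrite divr_gt0 //; last by nra.
move=> /(_ isT S 2^-1); rewrite S2 => lt1; nra.
Qed.
End Converse.

(** * From the asymptotic conditions to the explicit bounds *)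

Section Asymptotics.
Local Open Scope classical_set_scope.
Variable R : realType.
Implicit Types p : bool -> bool -> R.

(** As the total mass is 1, the covariance of the two edge indicators is p11 p00 - p10 p01. *)
Lemma positively_correlated_lt p : prob_vector p -> positively_correlated p ->
  p true false * p false true < p true true * p false false.
Proof.
move=> p_prob [v1 v2]; rewrite /correlation pmulr_lgt0; last first.
  by rewrite invr_gt0 mulr_gt0 // sqrtr_gt0.
have ps := prob_sum p_prob.
rewrite /pair_cov /pair_mean !big_bool /= /edge_ind1 /edge_ind2 /=.
have -> : p false false = 1 - p true true - p true false - p false true by lra.
rewrite !mulr1 !mulr0 !addr0 !add0r -[in X in _ -> X]subr_gt0 => cov_gt0.
by apply: lt_le_trans cov_gt0 _; rewrite le_eqVlt; apply/orP; left; apply/eqP; ring.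
Qed.

Lemma ln_sqr_le (n : nat) : (0 < n)%N -> 0 <= ln (n%:R : R) -> ln (n%:R : R) ^+ 2 <= 4 * n%:R.
Proof.
move=> n0; set L := ln _ => L0.
have eL : n%:R = expR (L / 2) ^+ 2.
  rewrite -expRM_natl mulrCA divff ?mulr1 ?pnatr_eq0 // /L lnK // posrE ltr0n //.
have := expR_ge1Dx (L / 2) => e1.
have e2 : L / 2 <= expR (L / 2) by lra.
have : (L / 2) ^+ 2 <= n%:R by rewrite eL ler_pXn2r ?nnegrE ?expR_ge0 ?divr_ge0.
rewrite expr_div_n; lra.
Qed.

(** With N = n + m, the gap gives n p11 <= L, and L^2 <= 4n then gives L p11 <= 4, so p11 <= 1/32.
    The mean number of isolated users is at least exp(L - N p11 - 2 N p11^2) >= 1 + 23 - 8 = 16,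
    since N p11^2 <= L p11. *)
Lemma error_ge_quarter (n m : nat) p (est : estimator n m) :
  (0 < n)%N -> prob_vector p -> positively_correlated p ->
  128 <= ln (n%:R : R) -> 23 <= ln (n%:R : R) - (n + m)%:R * p true true ->
  4^-1 <= error_prob p p est.
Proof.
move=> n0 p_prob /(positively_correlated_lt p_prob) pos.
set L := ln _ => L128 gap.
have p0 := prob_ge0 p_prob true true.
have nR : 0 < n%:R :> R by rewrite ltr0n.
have nn : n%:R <= (n + m)%:R :> R by rewrite ler_nat leq_addr.
have L0 : 0 <= L by lra.
have L2 : L ^+ 2 <= 4 * n%:R by apply: ln_sqr_le.
have np : n%:R * p true true <= L.
  by have := ler_wpM2r p0 nn; lra.
have Lp : L * p true true <= 4.
  rewrite -(ler_pM2l nR) mulrCA; apply: le_trans (ler_wpM2l L0 np) _; lra.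
have p32 : p true true <= 32^-1.
  by have := ler_wpM2r p0 L128; lra.
have h1p : 0 < 1 - p true true by lra.
set P := p true true in p0 np Lp p32 h1p gap *.
set N := (n + m)%:R in nn gap *.
(* This follows from (1 + P + 2 P^2) (1 - P) = 1 + P^2 - 2 P^3 >= 1. *)
have base : expR (- (P + 2 * P ^+ 2)) <= 1 - P.
  rewrite expRN -[leRHS]invrK lef_pV2 ?posrE ?invr_gt0 ?expR_gt0 //.
  apply: le_trans (expR_ge1Dx _); rewrite -[leLHS]mul1r ler_pdivrMr //.
  have PP0 := mulr_ge0 p0 p0; have PP : P * P <= P / 32 by rewrite ler_wpM2l.
  have PPP : P * (P * P) <= P * (P / 32) by rewrite ler_wpM2l.
  rewrite (_ : _ * (1 - P) = 1 + P * P - 2 * (P * (P * P))); last by ring.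
  lra.
have mu16 : 16 <= n%:R * (1 - P) ^+ (n + m).-1.
  apply: (@le_trans _ _ (n%:R * (1 - P) ^+ (n + m))); last first.
    rewrite ler_pM2l // -{1}(prednK (n := n + m)) ?addn_gt0 ?n0 // exprS.
    by rewrite ler_piMl ?exprn_ge0 //; lra.
  apply: (@le_trans _ _ (n%:R * expR (- (P + 2 * P ^+ 2)) ^+ (n + m))); last first.
    by rewrite ler_pM2l // lerXn2r ?nnegrE ?expR_ge0 //; lra.
  rewrite -expRM_natl -[in leRHS](@lnK _ n%:R) ?posrE // -/L -expRD -/N.
  apply: le_trans (expR_ge1Dx _).
  have NP : N * P * P <= L * P by rewrite ler_wpM2r //; lra.
  lra.
have := two_isolated_le p_prob est (ltW pos).
have := two_isolated_ge p_prob (erefl _) (erefl _) mu16 p32.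
lra.
Qed.
(** It turns a lower bound on n p11 + m psi into one on (n + m) p11. *)
Lemma psi_le_p11 p : prob_vector p -> positively_correlated p ->
  psi p <= p true true.
Proof.
move=> p_prob /(positively_correlated_lt p_prob)/ltW pos.
have p0 := prob_ge0 p_prob; have ps := prob_sum p_prob.
have p00 : p false false <= 1.
  by have := p0 true true; have := p0 true false; have := p0 false true; lra.
apply: (@le_trans _ _ (p true true * p false false)); last by rewrite ler_piMr.
rewrite -[leRHS]sqr_sqrtr ?mulr_ge0 // /psi.
have : Num.sqrt (p true false * p false true) <= Num.sqrt (p true true * p false false).
  by rewrite ler_wsqrtr.
have := sqrtr_ge0 (p true false * p false true).
move: (Num.sqrt (p true false * _)) (Num.sqrt (p true true * _)) => a b a0 ab.
by rewrite ler_pXn2r ?nnegrE //; lra.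
Qed.

(** With a^2 = p11 p00 and b^2 = p10 p01, (a - b)^2 >= a^2 - 2ab >= (1 - 2d) a^2. It lets n p11 be
    replaced by n psi at bounded cost. *)
Lemma psi_ge p (d : R) : prob_vector p -> 0 <= d ->
  Num.sqrt (p true false * p false true) <= d * Num.sqrt (p true true * p false false) ->
  p true true * (1 - (p true true + p true false + p false true + 2 * d)) <= psi p.
Proof.
move=> p_prob d0 hd; have p0 := prob_ge0 p_prob; have ps := prob_sum p_prob.
have p00 : p false false <= 1.
  by have := p0 true true; have := p0 true false; have := p0 false true; lra.
rewrite /psi; move: hd (sqrtr_ge0 (p true false * p false true)).
have := sqr_sqrtr (mulr_ge0 (p0 true true) (p0 false false)).
have := sqrtr_ge0 (p true true * p false false).
move: (Num.sqrt (p true true * _)) (Num.sqrt (p true false * _)) => a b a0 aE ba b0.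
apply: (@le_trans _ _ (a ^+ 2 - 2 * (a * (d * a)))); last first.
  have := ler_wpM2l a0 ba; have := sqr_ge0 b.
  rewrite (_ : (a - b) ^+ 2 = a ^+ 2 - 2 * (a * b) + b ^+ 2); last by ring.
  lra.
rewrite (_ : a * (d * a) = d * a ^+ 2); last by ring.
rewrite aE.
have -> : 1 - (p true true + p true false + p false true + 2 * d) = p false false - 2 * d.
  by lra.
rewrite mulrBr lerD2l lerN2.
have ad : 0 <= d * p true true by rewrite mulr_ge0.
have := ler_wpM2l ad p00; lra.
Qed.

(** Condition (b) with one constant C for its three bounds. The constant subtracted in [om] pays for
    replacing n p11 by n psi (7 C^2), for 16 psi n / L (16 C) and for 3 psi / 2 (1). *)
Lemma error_le_sparse_regime (n m : nat) p (est : estimator n m) (C : R) :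
  (0 < n)%N -> prob_vector p -> positively_correlated p -> is_MAP p p est ->
  1 <= C -> 32 <= ln (n%:R : R) -> 12 * C * expR 96 ^+ 2 <= ln (n%:R : R) ->
  p true true <= C * (ln n%:R / n%:R) ->
  p true false + p false true <= C * (ln n%:R)^-1 ->
  p true false * p false true / (p true true * p false false) <= C * (ln n%:R ^+ 3)^-1 ->
  forall om : R,
    om = n%:R * p true true + m%:R * psi p - ln n%:R - (7 * C ^+ 2 + 16 * C + 1) ->
    1 <= om ->
  error_prob p p est <= 2 * expR (- om) + expR (- n%:R) + 2 * expR (- ln n%:R).
Proof.
move=> n0 p_prob corr MAP C1; set L := ln _ => L32 LC h11 h10 hrho om omE om1.
have pos := positively_correlated_lt p_prob corr.
have p0 := prob_ge0 p_prob.
have nR : 0 < n%:R :> R by rewrite ltr0n.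
have L0 : 0 < L by lra.
have C0 : 0 <= C by lra.
have L2 : L ^+ 2 <= 4 * n%:R by apply: ln_sqr_le => //; exact: ltW.
set rho := _ / _ in hrho; set d := Num.sqrt rho.
have pp : 0 < p true true * p false false by apply: le_lt_trans pos; rewrite mulr_ge0.
have rho0 : 0 <= rho by rewrite divr_ge0 ?mulr_ge0.
have d0 : 0 <= d by rewrite sqrtr_ge0.
have hd : Num.sqrt (p true false * p false true) <= d * Num.sqrt (p true true * p false false).
  by rewrite /d -sqrtrM // divfK // gt_eqF.
have p11L : n%:R * p true true <= C * L.
  by rewrite mulrC -ler_pdivlMr // -mulrA.
(* All error terms are multiples of C / L: L / n <= 4 / L because L^2 <= 4n, and d^2 <= C / L^3 <=
   (C / L)^2 because C, L >= 1. *)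
have p11C : p true true <= 4 * (C / L).
  rewrite (le_trans h11) // [leRHS]mulrCA ler_wpM2l // ler_pdivrMr // -(ler_pM2r L0).
  by rewrite -expr2 (le_trans L2) // mulrAC divfK // gt_eqF.
have dC : d <= C / L.
  have CL0 : 0 <= C / L by rewrite divr_ge0 // ltW.
  rewrite -[leRHS]ger0_norm // -sqrtr_sqr ler_sqrt ?sqr_ge0 // (le_trans hrho) //.
  rewrite expr_div_n ler_pM ?invr_ge0 ?exprn_ge0 ?(ltW L0) //.
    by rewrite expr2 ler_peMl.
  by rewrite lef_pV2 ?posrE ?exprn_gt0 // ler_weXn2l //; lra.
have sumC : p true true + p true false + p false true + 2 * d <= 7 * (C / L) by lra.
have psi0 := psi_ge0 p; have psi2 := psi_le1 p_prob.
have psi11 := psi_le_p11 p_prob corr.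
have nm : (n + m)%:R = n%:R + m%:R :> R by rewrite natrD.
have mpsi : m%:R * psi p <= m%:R * p true true by rewrite ler_wpM2l.
have C2 : 0 <= C ^+ 2 by rewrite sqr_ge0.
apply: (error_le_sparse p_prob n0 MAP om1 _ L32 _ d0 hd).
- have gap : n%:R * p true true - n%:R * psi p <= 7 * C ^+ 2.
    have := ler_wpM2l (ltW nR) (psi_ge p_prob d0 hd).
    have np0 : 0 <= n%:R * p true true by rewrite mulr_ge0 // ltW.
    have := ler_wpM2l np0 sumC.
    have CL0 : 0 <= 7 * (C / L) by rewrite mulr_ge0 ?divr_ge0 // ltW.
    have := ler_wpM2r CL0 p11L.
    have -> : C * L * (7 * (C / L)) = 7 * C ^+ 2 by field; rewrite gt_eqF.
    lra.
  have psiL : psi p * (16 * (n%:R / L)) <= 16 * C.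
    rewrite mulrCA ler_wpM2l // mulrA ler_pdivrMr // mulrC (le_trans _ p11L) //.
    by rewrite ler_wpM2l // ltW.
  rewrite -/L nm; lra.
- rewrite -/L nm; lra.
(* With d taken once, the sum is at most (4 + 1 + 1) C / L; the factor 4 makes it 24 C / L, whence
   the threshold 12 C exp(96)^2 <= L. *)
- have LC' : 24 * (C / L) * expR 96 ^+ 2 <= 2.
    rewrite (_ : _ * _ = 24 * C * expR 96 ^+ 2 / L); last by ring.
    by rewrite ler_pdivrMr //; lra.
  rewrite mulrC; apply: le_trans LC'; rewrite ler_wpM2r ?sqr_ge0 //; lra.
Qed.

Lemma ln_natr_near (A : R) : \forall n \near \oo, A <= ln (n%:R : R).
Proof.
near=> n; rewrite -[leLHS]expRK ler_ln ?posrE ?expR_gt0 //.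
  by near: n; exact: nbhs_infty_ger.
by rewrite ltr0n; near: n; exact: nbhs_infty_gt.
Unshelve. all: by end_near. Qed.

(** Shared by both conditions; under (a) the last two terms are added as nonnegative slack. *)
Lemma error_cvg0 (m : nat -> nat) (p : nat -> bool -> bool -> R)
    (est : forall n, estimator n (m n)) (om : nat -> R) :
  (forall n, (0 < n)%N -> prob_vector (p n)) -> om @ \oo --> +oo ->
  (\forall n \near \oo, error_prob (p n) (p n) (est n) <=
     2 * expR (- om n) + expR (- n%:R) + 2 * expR (- ln n%:R)) ->
  (fun n => error_prob (p n) (p n) (est n)) @ \oo --> (0 : R).
Proof.
move=> p_prob om_oo le_near.
have cexp (u : nat -> R) : u @ \oo --> +oo -> expR (- u n) @[n --> \oo] --> (0 : R).
  by move=> u_oo; exact: (cvg_comp _ _ u_oo (@cvgr_expR R)).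
apply: (@squeeze_cvgr _ _ _ _ (fun=> 0)
  (fun n => 2 * expR (- om n) + expR (- n%:R) + 2 * expR (- ln n%:R))).
- near=> n; rewrite (near le_near n) // andbT /error_prob /Pr.
  apply: sumr_ge0 => w _; apply: mass_ge0; apply: p_prob.
  by near: n; exact: nbhs_infty_gt.
- exact: cvg_cst.
have -> : (0 : R) = 2 * 0 + 0 + 2 * 0 by rewrite !mulr0 !addr0.
apply: cvgD; first apply: cvgD.
- by apply: (cvgM (cvg_cst _)); exact: cexp.
- apply: cexp; apply/cvgryPge => A; exact: nbhs_infty_ger.
- by apply: (cvgM (cvg_cst _)); apply: cexp; apply/cvgryPge => A; exact: ln_natr_near.
Unshelve. all: by end_near. Qed.
End Asymptotics.

(** * Limit inferior and assembly of the theorem *)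

Lemma limn_einf_ge_near (R : realType) (u : nat -> R) (c : R) :
  (\forall n \near \oo%classic, c <= u n) ->
  (c%:E <= limn_einf (fun n => (u n)%:E))%E.
Proof.
move=> [N _ uN]; rewrite limn_einf_lim; apply: lime_ge; first exact: is_cvg_einfs.
exists N => // k /= Nk; apply: le_ereal_inf_tmp => _ [j /= kj] <-.
by rewrite lee_fin; apply: uN; exact: leq_trans kj.
Qed.

Local Open Scope classical_set_scope.
Local Open Scope ring_scope.

Theorem theorem7 (R : realType) (m : nat -> nat) (p : nat -> bool -> bool -> R)
    (p_prob : forall n : nat, (0 < n)%N -> prob_vector (p n))
    (p_corr : forall n : nat, (0 < n)%N -> positively_correlated (p n)) :
  (((fun n : nat => (n + m n)%:R * psi (p n) - 2 * ln (n%:R : R)) @ \oo --> +oo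
    \/
    [/\ (fun n : nat => p n true true) =O_\oo
          (fun n : nat => ln (n%:R : R) / n%:R),
        (fun n : nat => p n true false + p n false true) =O_\oo
          (fun n : nat => (ln (n%:R : R))^-1),
        (fun n : nat => (p n true false * p n false true)
                        / (p n true true * p n false false)) =O_\oo
          (fun n : nat => (ln (n%:R : R) ^+ 3)^-1) &
        (fun n : nat => n%:R * p n true true + (m n)%:R * psi (p n)
                        - ln (n%:R : R)) @ \oo --> +oo]) ->
   forall est : forall n : nat, estimator n (m n),
     (forall n : nat, is_MAP (p n) (p n) (est n)) ->
     (fun n : nat => error_prob (p n) (p n) (est n)) @ \oo --> (0 : R))
  /\
  ((fun n : nat => ln (n%:R : R) - (n + m n)%:R * p n true true) @ \oo --> +oo ->
   forall est : forall n : nat, estimator n (m n),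
     (0 < limn_einf (fun n : nat => (error_prob (p n) (p n) (est n))%:E))%E).
Proof.
split; last first.
  move=> gap est; apply: (@lt_le_trans _ _ (4^-1)%:E); first by rewrite lte_fin.
  apply: limn_einf_ge_near; near=> n.
  have n0 : (0 < n)%N by near: n; exact: nbhs_infty_gt.
  apply: error_ge_quarter => //; [exact: p_prob | exact: p_corr | |].
    by near: n; exact: ln_natr_near.
  by near: n; move/cvgryPge: gap; apply.
move=> [dense|[h11 h10 hrho sparse]] est MAP.
  pose om n := ((n + m n)%:R * psi (p n) - 2 * ln (n%:R : R)) / 2 - 1.
  have om_oo : om @ \oo --> +oo.
    apply/cvgryPge => A; near=> n; rewrite /om lerBrDr ler_pdivlMr //.
    by near: n; move/cvgryPge: dense; apply.
  apply: (error_cvg0 p_prob om_oo); near=> n.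
  have n0 : (0 < n)%N by near: n; exact: nbhs_infty_gt.
  rewrite -addrA -[leLHS]addr0 lerD //.
  apply: (error_le_dense (p_prob n n0) n0 (MAP n) _ (lexx _)).
  by near: n; move/cvgryPge: om_oo; apply.
move/eqOP: h11 => h11; move/eqOP: h10 => h10; move/eqOP: hrho => hrho.
(* Each O bound holds for all sufficiently large constants, so one C >= 1 serves all three. *)
have [C [C1 c11 c10 crho]] : exists C : R, [/\ 1 <= C,
    \forall n \near \oo, `|p n true true| <= C * `|ln (n%:R : R) / n%:R|,
    \forall n \near \oo, `|p n true false + p n false true| <= C * `|(ln (n%:R : R))^-1| &
    \forall n \near \oo, `|(p n true false * p n false true)
       / (p n true true * p n false false)| <= C * `|(ln (n%:R : R) ^+ 3)^-1|].
  near (pinfty_nbhs R) => C; exists C; split.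
  - by near: C; exact: nbhs_pinfty_ge.
  - by near: C; exact: h11.
  - by near: C; exact: h10.
  - by near: C; exact: hrho.
pose om n := n%:R * p n true true + (m n)%:R * psi (p n) - ln (n%:R : R)
  - (7 * C ^+ 2 + 16 * C + 1).
have om_oo : om @ \oo --> +oo.
  apply/cvgryPge => A; near=> n; rewrite /om lerBrDr.
  by near: n; move/cvgryPge: sparse; apply.
apply: (error_cvg0 p_prob om_oo); near=> n.
have n0 : (0 < n)%N by near: n; exact: nbhs_infty_gt.
(* A positive logarithm removes the absolute values from the O bounds. *)
have L1 : 1 <= ln (n%:R : R) by near: n; exact: ln_natr_near.
have L0 : 0 < ln (n%:R : R) by apply: lt_le_trans L1.
apply: (@error_le_sparse_regime R n (m n) (p n) (est n) C n0 (p_prob n n0) (p_corr n n0)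
  (MAP n) C1 _ _ _ _ _ (om n) (erefl _)).
- by near: n; exact: ln_natr_near.
- by near: n; exact: ln_natr_near.
- rewrite -[ln _ / _]ger0_norm; last by rewrite divr_ge0 // ltW.
  by apply: le_trans (ler_norm _) _; near: n; exact: c11.
- rewrite -[(ln _)^-1]ger0_norm; last by rewrite invr_ge0 ltW.
  by apply: le_trans (ler_norm _) _; near: n; exact: c10.
- rewrite -[(ln _ ^+ 3)^-1]ger0_norm; last by rewrite invr_ge0 exprn_ge0 // ltW.
  by apply: le_trans (ler_norm _) _; near: n; exact: crho.
- by near: n; move/cvgryPge: om_oo; apply.
Unshelve. all: by end_near. Qed.
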